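(* Let $\nu\ge 3$ be an integer. For each $n$ let $X_1,\dots,X_n$ be independent random integers uniformly distributed on $\{1,\dots,M\}$, where $M=M(n)\to\infty$, and let $Z_n$ be the number of perfect ordered partitions of $[n]$ into $\nu$ non-empty subsets. Suppose $\lim\frac{n}{\log M}>\frac{2(\nu-1)}{\log[(1-2\nu^{-2})^{-1}]}$. Then $\mathbb E[Z_n]$ grows exponentially fast in $n$, and with limiting probability at least (essentially) $(1+\nu^2)^{-1}$, $Z_n$ is of the same order as $\mathbb E[Z_n]$; precisely, for every $\delta\in(0,1)$, $$\liminf_{n\to\infty}\mathbb P\bigl(Z_n\ge\delta\,\mathbb E[Z_n]\bigr)\ge\frac{(1-\delta)^2}{(1-\delta)^2+\nu^2}.$$
   Context: An ordered partition of $[n]$ into $\nu$ non-empty subsets is a $\nu$-tuple $(S_1,\dots,S_\nu)$ of non-empty pairwise disjoint subsets of $[n]$ with union $[n]$; it is perfect if all sums $\sum_{j\in S_\alpha}X_j$, $\alpha\in[\nu]$, are equal. *)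

(* Defs.v *)
From mathcomp Require Import all_boot all_order all_algebra.

Set Implicit Arguments.
Unset Strict Implicit.
Unset Printing Implicit Defensive.

(* Indices are shifted by one: [n] = {1, ..., n} is represented by 'I_n and a
   nu-tuple of subsets of [n] by a finite function on 'I_nu. *)
Definition ordered_partition (nu n : nat) (S : {ffun 'I_nu -> {set 'I_n}}) :
    bool :=
  [&& [forall a, S a != set0],
      [forall a, forall b, (a != b) ==> [disjoint S a & S b]] &
      \bigcup_(a < nu) S a == [set: 'I_n]].

Definition perfect (nu n : nat) (x : 'I_n -> nat)
    (S : {ffun 'I_nu -> {set 'I_n}}) : bool :=
  [forall a, forall b, \sum_(j in S a) x j == \sum_(j in S b) x j].

Definition num_perfect_partitions (nu n : nat) (x : 'I_n -> nat) : nat :=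
  #|[pred S : {ffun 'I_nu -> {set 'I_n}} |
      ordered_partition S && perfect x S]|.

From mathcomp Require Import all_classical all_reals all_analysis.
Import Order.TTheory GRing.Theory Num.Theory.
Import numFieldNormedType.Exports.

Local Open Scope classical_set_scope.
Local Open Scope ring_scope.
Local Open Scope ereal_scope.

Definition mutually_independent (R : realType) (d d' : measure_display)
    (T : measurableType d) (T' : measurableType d') (P : probability T R)
    (I : finType) (X : I -> {RV P >-> T'}) : Prop :=
  forall (J : {set I}) (A : I -> set T'),
    (forall i, measurable (A i)) ->
    P [set w | forall i, i \in J -> A i (X i w)] =
    \prod_(i in J) P (X i @^-1` A i).

(* No condition is needed off {1, ..., m}: for 0 < m the atoms below already
   carry the whole mass. *)
Definition uniform_on_1_to (R : realType) (d : measure_display)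
    (T : measurableType d) (P : probability T R) (m : nat)
    (X : {RV P >-> nat}) : Prop :=
  forall k : nat, (1 <= k <= m)%N -> distribution P X [set k] = (m%:R^-1)%:E.

Definition Z (R : realType) (d : measure_display) (T : measurableType d)
    (P : probability T R) (nu n : nat) (X : 'I_n -> {RV P >-> nat}) (w : T) : R :=
  (num_perfect_partitions nu (fun i => X i w))%:R.

(* Main.v *)
Require Import Defs.
From mathcomp Require Import all_boot all_order all_algebra.
From mathcomp Require Import all_classical all_reals all_analysis.
From mathcomp.real_closed Require Import complex.
From mathcomp Require Import ring lra zify.
Import Order.TTheory GRing.Theory Num.Theory.
Import numFieldNormedType.Exports.
Import Normc.

Local Open Scope classical_set_scope.
Local Open Scope ring_scope.

Set Implicit Arguments.
Unset Strict Implicit.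
Unset Printing Implicit Defensive.

(** Second moment method with finite Fourier analysis.  As the X_j are positive,
    a perfect partition is a map s : [n] -> [nu] whose fibres have equal sums,
    and these sums are at most n M < N := nu n M.  Averaging characters over the
    zero-sum frequencies th in (Z/N)^nu detects this, so that, up to
    normalisation, E Z = sum_th Phi(th,0)^n and E Z^2 = sum_(th,et) Phi(th,et)^n,
    where Phi(th,et) is the mean of the characteristic function of the uniform
    law on {1..M} over the nu^2 angles th_a + et_b.

    - If some th_a + et_b is much larger than N / M, then so is another one, and
      |Phi| <= 1 - 2 / nu^2 + small; there are at most N^(2 (nu - 1)) such
      pairs, which is negligible exactly above the threshold.
    - If all these angles are O(N / M) but one exceeds the scale N n^(-2/5) / M,
      then |Phi|^n <= exp(- c n^(1/5)), and there are only polynomially many such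
      pairs.
    - Otherwise, up to one of the nu shifts (th + c, et - c) with nu c = 0, both
      th and et are small, and Phi(th,et)^n is close to the product of Gaussians
      g(th) g(et), while Phi(th,0)^n is close to g(th).

    Hence E Z^2 / (E Z)^2 is asymptotically at most nu.  It is enough to reach
    1 + nu^2, so fixed constants replace all the o(1), and the Gaussian sums are
    compared with each other without being evaluated.  Cantelli's inequality
    concludes. *)

(** * Trigonometric estimates *)

Section Trigonometry.
Variable R : realType.
Implicit Types (x t : R) (z : R[i]).

(** The mean value theorem on [0, x]. Starting from cos <= 1, each Taylor bound on sine or cosine
    below follows from the preceding one, which bounds its derivative. *)
Lemma nonneg_of_deriv (f df : R -> R) x :
  (forall t, is_derive t 1 f (df t)) -> (forall t, 0 <= t -> 0 <= df t) ->
  0 <= f 0 -> 0 <= x -> 0 <= f x.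
Proof.
move=> fdf df0 f0; rewrite le_eqVlt => /predU1P[<-//|x0].
have cf : {within `[0, x], continuous f}.
  by apply: derivable_within_continuous => t _; have [] := fdf t.
have [c] := MVT x0 (fun t _ => fdf t) cf.
rewrite in_itv/= => /andP[c0 _] /eqP; rewrite subr_eq => /eqP ->.
by rewrite addr_ge0// mulr_ge0 ?df0 ?subr_ge0// ltW.
Qed.

Lemma sin_le x : 0 <= x -> sin x <= x.
Proof.
move=> x0; rewrite -subr_ge0.
apply: (@nonneg_of_deriv (fun t => t - sin t) (fun t => 1 - cos t)) => //.
by rewrite sin0 subrr.
Qed.

Lemma cos_ge x : 1 - x ^+ 2 / 2 <= cos x.
Proof.
wlog x0 : x / 0 <= x.
  move=> h; have [x0|/ltW x0] := leP 0 x; first exact: h.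
  by rewrite -(sqrrN x) -cosN h// oppr_ge0.
rewrite -subr_ge0.
apply: (@nonneg_of_deriv (fun t => cos t - (1 - t ^+ 2 / 2))
                         (fun t => t - sin t)) => //.
- move=> t; apply: is_derive_eq.
  by rewrite /GRing.scale/=; lra.
- by move=> t t0; rewrite subr_ge0 sin_le.
- by rewrite /= cos0 expr0n/=; lra.
Qed.

Lemma sin_ge x : 0 <= x -> x - x ^+ 3 / 6 <= sin x.
Proof.
move=> x0; rewrite -subr_ge0.
apply: (@nonneg_of_deriv (fun t => sin t - (t - t ^+ 3 / 6))
                         (fun t => cos t - (1 - t ^+ 2 / 2))) => //.
- move=> t; apply: is_derive_eq.
  by rewrite /GRing.scale/=; lra.
- by move=> t t0; rewrite subr_ge0 cos_ge.
- by rewrite /= sin0 expr0n/=; lra.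
Qed.

Lemma cos_le x : cos x <= 1 - x ^+ 2 / 2 + x ^+ 4 / 24.
Proof.
wlog x0 : x / 0 <= x.
  move=> h; have [x0|/ltW x0] := leP 0 x; first exact: h.
  have -> : x ^+ 4 = (- x) ^+ 4 by ring.
  by rewrite -(sqrrN x) -(cosN x) h// oppr_ge0.
rewrite -subr_ge0.
apply: (@nonneg_of_deriv (fun t => 1 - t ^+ 2 / 2 + t ^+ 4 / 24 - cos t)
                         (fun t => sin t - (t - t ^+ 3 / 6))) => //.
- move=> t; apply: is_derive_eq.
  by rewrite /GRing.scale/=; lra.
- by move=> t t0; rewrite subr_ge0 sin_ge.
- by rewrite /= cos0 !expr0n/=; lra.
Qed.

Lemma sin_approx x : `|sin x - x| <= `|x| ^+ 3 / 6.
Proof.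
wlog x0 : x / 0 <= x.
  move=> h; have [x0|/ltW x0] := leP 0 x; first exact: h.
  have := h (- x); rewrite oppr_ge0 sinN normrN => /(_ x0).
  have -> : - sin x - - x = - (sin x - x) by ring.
  by rewrite normrN.
have := sin_ge x0; have := sin_le x0; rewrite (ger0_norm x0) ler_norml.
move=> h1 h2; apply/andP; split; first by lra.
by have := exprn_ge0 3 x0; lra.
Qed.

Lemma cos_approx x : `|cos x - (1 - x ^+ 2 / 2)| <= `|x| ^+ 4 / 24.
Proof.
have := cos_ge x; have := cos_le x.
have -> : `|x| ^+ 4 = x ^+ 4.
  by rewrite -normrX ger0_norm// (_ : x ^+ 4 = (x ^+ 2) ^+ 2) ?sqr_ge0//; ring.
have : 0 <= x ^+ 4 by rewrite (_ : x ^+ 4 = (x ^+ 2) ^+ 2) ?sqr_ge0//; ring.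
by rewrite ler_norml => ? ? ?; apply/andP; split; lra.
Qed.

(** Halving the angle brings it into [0, 2], where the cubic bound gives [sin y >= y / 3]; then cos
    2y = 1 - 2 sin^2 y. As 4 exceeds pi, the range covers every angle reduced modulo 2 pi. *)
Lemma cos_le_quadratic x : `|x| <= 4 -> cos x <= 1 - x ^+ 2 / 18.
Proof.
wlog x0 : x / 0 <= x.
  move=> h; have [x0|/ltW x0] := leP 0 x; first exact: h.
  by rewrite -(sqrrN x) -(cosN x) -normrN; apply: h; rewrite oppr_ge0.
rewrite ger0_norm// => x4.
have -> : x = (x / 2) *+ 2 by rewrite -mulr_natr; lra.
set y := x / 2; have y0 : 0 <= y by rewrite /y; lra.
have y2 : y <= 2 by rewrite /y; lra.
have h : y / 3 <= sin y.
  have := sin_ge y0; have : 0 <= y * (4 - y ^+ 2) by apply: mulr_ge0 => //; nra.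
  by rewrite mulrBr exprS; lra.
have : (y / 3) ^+ 2 <= sin y ^+ 2 by rewrite lerXn2r// ?nnegrE; lra.
by rewrite cos_mulr2n cos2sin2 !mulr2n; lra.
Qed.

(** * Points of the unit circle and their geometric sums *)

Definition cis x : R[i] := (cos x +i* sin x)%C.

Lemma cisD x t : cis (x + t) = cis x * cis t.
Proof.
by rewrite /cis cosD sinD; apply/eqP; rewrite eq_complex/= eqxx/= addrC.
Qed.

Lemma cis0 : cis 0 = 1.
Proof. by rewrite /cis cos0 sin0. Qed.

Lemma cis_natmul x k : cis (x *+ k) = cis x ^+ k.
Proof. by elim: k => [|k IH]; rewrite ?mulr0n ?cis0// mulrS exprS cisD IH. Qed.

Lemma cisN x : cis (- x) * cis x = 1.
Proof. by rewrite -cisD addNr cis0. Qed.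

Lemma cis_period : cis (pi *+ 2) = 1.
Proof. by rewrite /cis cos2pi sin2pi. Qed.

Lemma normc_cis x : normc (cis x) = 1.
Proof. by rewrite /normc/= cos2Dsin2 sqrtr1. Qed.

Lemma normcX z k : normc (z ^+ k) = normc z ^+ k.
Proof.
elim: k => [|k IH]; first by rewrite !expr0 normc1.
by rewrite !exprS normcM IH.
Qed.

Lemma normc_ge0 z : 0 <= normc z.
Proof. by case: z => a b; rewrite sqrtr_ge0. Qed.

Lemma normc_real x : normc (x%:C)%C = `|x|.
Proof. by rewrite /normc/= expr0n/= addr0 sqrtr_sqr. Qed.

Lemma normc_sum (I : Type) (r : seq I) (Q : pred I) (F : I -> R[i]) :
  normc (\sum_(i <- r | Q i) F i) <= \sum_(i <- r | Q i) normc (F i).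
Proof.
elim/big_ind2 : _ => // [|x1 x2 y1 y2 h1 h2]; first by rewrite normc0.
by apply: le_trans (le_normcD _ _) _; apply: lerD.
Qed.

Lemma normc_le z (a b : R) : `|complex.Re z| <= a -> `|complex.Im z| <= b
  -> normc z <= a + b.
Proof.
case: z => u v /= ua vb.
have a0 : 0 <= a by apply: le_trans ua.
have b0 : 0 <= b by apply: le_trans vb.
rewrite -(ger0_norm (addr_ge0 a0 b0)) -sqrtr_sqr ler_sqrt ?sqr_ge0//.
have : u ^+ 2 <= a ^+ 2 by rewrite -real_normK ?num_real// lerXn2r// ?nnegrE.
have : v ^+ 2 <= b ^+ 2 by rewrite -real_normK ?num_real// lerXn2r// ?nnegrE.
by have := mulr_ge0 a0 b0; lra.
Qed.

Lemma Re_le_normc z : `|complex.Re z| <= normc z.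
Proof.
by case: z => u v /=; rewrite -sqrtr_sqr ler_sqrt ?lerDl ?sqr_ge0// addr_ge0 ?sqr_ge0.
Qed.

Lemma normc_sq z : normc z ^+ 2 = complex.Re z ^+ 2 + complex.Im z ^+ 2.
Proof. by case: z => u v /=; rewrite sqr_sqrtr// addr_ge0// sqr_ge0. Qed.

Lemma normc_1Bcis t : `|t| <= 4 -> `|t| / 3 <= normc (1 - cis t).
Proof.
move=> /cos_le_quadratic h.
rewrite -(@ler_pXn2r _ 2)// ?nnegrE ?normc_ge0 ?divr_ge0//.
rewrite normc_sq/= exprMn real_normK ?num_real//.
by have := cos2Dsin2 t; lra.
Qed.

Lemma normc_1Dcis t : `|t| <= 4 -> normc (1 + cis t) <= 2 - t ^+ 2 / 36.
Proof.
move=> h4; have h := cos_le_quadratic h4.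
have h16 : t ^+ 2 <= 16.
  by rewrite -real_normK ?num_real//; have := normr_ge0 t; nra.
rewrite -(@ler_pXn2r _ 2)// ?nnegrE ?normc_ge0//; last by lra.
rewrite normc_sq/=; have := cos2Dsin2 t; have := sqr_ge0 (t^+2).
by lra.
Qed.

(** Multiplication by [1 - cis t] telescopes the sum to a difference of two unit numbers, while
    [1 - cis t] has modulus at least |t| / 3. *)
Lemma normc_geometric (M : nat) t : `|t| <= 4 -> t != 0 ->
  normc (\sum_(x < M) cis (t *+ x.+1)) <= 6 / `|t|.
Proof.
move=> t4 t0; have tp : 0 < `|t| by rewrite normr_gt0.
set S := \sum_(x < M) _.
have E : (1 - cis t) * S = cis t - cis (t *+ M.+1).
  rewrite /S; elim: M {S} => [|M IH]; first by rewrite big_ord0 mulr0 subrr.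
  rewrite big_ord_recr/= mulrDr {}IH mulrBl mul1r -cisD -mulrS.
  by rewrite addrA addrNK.
have : normc ((1 - cis t) * S) <= 2.
  rewrite E; apply: le_trans (le_normcD _ _) _.
  by rewrite normcN !normc_cis.
rewrite normcM => h; have h3 := normc_1Bcis t4.
rewrite ler_pdivlMr//; have := normc_ge0 S; nra.
Qed.

(* Pairing the terms x and x + h, for a shift h close to M / 4. *)
Lemma normc_pairing (M : nat) t : (4 <= M)%N -> M%:R * `|t| <= 12 ->
  normc (\sum_(x < M) cis (t *+ x.+1)) <= M%:R * (1 - (M%:R * t) ^+ 2 / (200 * 100)).
Proof.
move=> M4 tM; pose h := (M %/ 4)%N.
have hM : (h + h <= M)%N by rewrite /h; lia.
have h8 : (M <= 8 * h)%N by rewrite /h; lia.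
have h4 : (4 * h <= M)%N by rewrite /h; lia.
rewrite -(big_mkord predT (fun j => cis (t *+ j.+1))).
(* The blocks [0, h) and [h, 2h) are paired term by term; the remaining M - 2h terms are bounded by
   1 each. *)
rewrite (big_cat_nat (leq0n _) hM)/= (big_cat_nat (leq0n _) (leq_addr h h))/=.
rewrite -{2}(add0n h) big_addn addnK -big_split/=.
have b1 : normc (\sum_(0 <= i < h) (cis (t *+ i.+1) + cis (t *+ (i + h).+1)))
    <= h%:R * (2 - (h%:R * t) ^+ 2 / 36).
  apply: le_trans (normc_sum _ _ _) _.
  rewrite -[leRHS]mulrC mulr_natr -[X in _ *+ X]subn0 -sumr_const_nat.
  apply: ler_sum => i _.
  rewrite -addSn mulrnDr cisD -{1}(mulr1 (cis _)) -mulrDr normcM normc_cis mul1r.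
  rewrite mulr_natl; apply: normc_1Dcis.
  rewrite normrMn -mulr_natl.
  have : (4 * h)%:R * `|t| <= M%:R * `|t| by rewrite ler_wpM2r// ler_nat.
  by rewrite natrM; lra.
have b2 : normc (\sum_(h + h <= i < M) cis (t *+ i.+1)) <= M%:R - 2 * h%:R.
  apply: le_trans (normc_sum _ _ _) _.
  under eq_bigr do rewrite normc_cis.
  by rewrite sumr_const_nat natrB// natrD; lra.
apply: le_trans (le_normcD _ _) _; apply: le_trans (lerD b1 b2) _.
have h0 : (0:R) <= h%:R by [].
have H8 : M%:R <= 8 * h%:R :> R by rewrite -natrM ler_nat.
have H4 : 4 * h%:R <= M%:R :> R by rewrite -natrM ler_nat.
have M0 : (0:R) <= M%:R by [].
rewrite !exprMn; set H := h%:R in h0 H8 H4 *; set m := M%:R in M0 H8 H4 *.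
have t2 := sqr_ge0 t.
(* The pairing gains [H ^+ 3 * t ^+ 2 / 36] with m <= 8 H, and 36 * 512 = 18432 is below 200 *
   100. *)
have : m ^+ 3 <= 512 * H ^+ 3.
  have -> : 512 * H ^+ 3 = (8 * H) ^+ 3 by ring.
  by apply: lerXn2r; rewrite ?nnegrE// mulr_ge0.
rewrite -subr_ge0 => k; have := mulr_ge0 k t2.
have := mulr_ge0 (exprn_ge0 3 M0) t2.
rewrite !exprS !expr0; lra.
Qed.

(** The characteristic function of the uniform law on {1, ..., M}; the ordinal x stands for the
    value x + 1. *)
Definition char_fun (M : nat) t : R[i] := (\sum_(x < M) cis (t *+ x.+1)) / M%:R.

Lemma normc_divn z (k : nat) : normc (z / k%:R) = normc z / k%:R.
Proof.
by rewrite normcM normcV -(rmorph_nat (real_complex R)) normc_real normr_nat.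
Qed.

Lemma char_fun_decay (M : nat) t : (0 < M)%N -> `|t| <= 4 -> t != 0 ->
  normc (char_fun M t) <= 6 / (M%:R * `|t|).
Proof.
move=> M0 t4 t0; rewrite normc_divn invfM [_^-1 * _]mulrC mulrA.
by rewrite ler_pM2r ?invr_gt0 ?ltr0n// normc_geometric.
Qed.

Lemma char_fun_le1 (M : nat) t : normc (char_fun M t) <= 1.
Proof.
rewrite normc_divn; have [->|M0] := posnP M; first by rewrite invr0 mulr0.
rewrite ler_pdivrMr ?ltr0n// mul1r; apply: le_trans (normc_sum _ _ _) _.
under eq_bigr do rewrite normc_cis.
by rewrite sumr_const card_ord.
Qed.

(** Up to M |t| = 12 the pairing gives the loss; beyond, the geometric sum already has mean below 1
    / 2. Capping u at 1 lets one formula serve both ranges. *)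
Lemma char_fun_gap (M : nat) t u : (4 <= M)%N -> `|t| <= 4 -> 0 <= u <= 1 ->
  u <= M%:R * `|t| -> normc (char_fun M t) <= 1 - u ^+ 2 / (200 * 100).
Proof.
move=> M4 t4 /andP[u0 u1] uM.
have M0 : (0 : R) < M%:R by rewrite ltr0n; lia.
have [tM|tM] := leP (M%:R * `|t|) 12.
  rewrite normc_divn ler_pdivrMr// mulrC.
  apply: le_trans (normc_pairing M4 tM) _.
  have : u ^+ 2 <= (M%:R * t) ^+ 2.
    rewrite -[leRHS]real_normK ?num_real//.
    by rewrite normrM normr_nat lerXn2r ?nnegrE ?mulr_ge0.
  by move=> h; rewrite ler_wpM2l ?(ltW M0)//; lra.
have t0 : t != 0 by apply: contraTneq tM => ->; rewrite normr0 mulr0 -leNgt.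
apply: le_trans (char_fun_decay _ t4 t0) _; first by lia.
rewrite ler_pdivrMr; last by lra.
have u2 : u ^+ 2 <= 1 by rewrite expr_le1.
have : 0 <= (M%:R * `|t| - 12) * (1 - u ^+ 2) by rewrite mulr_ge0; lra.
lra.
Qed.

(** The linear terms cancel because the [y k] sum to zero, and each Taylor remainder is at most
    [w ^+ 3 / 6 + w ^+ 4 / 24]. *)
Lemma mean_cis_approx (K : finType) (y : K -> R) (w q : R) :
  (0 < #|K|)%N -> 0 <= w <= 1 -> (forall k, `|y k| <= w) -> \sum_k y k = 0 ->
  q = (\sum_k y k ^+ 2) / 2 / #|K|%:R ->
  normc ((\sum_k cis (y k)) / #|K|%:R - ((1 - q)%:C)%C) <= w ^+ 3.
Proof.
move=> K0 /andP[w0 w1] yw ysum Dq.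
have k0 : (0 : R) < #|K|%:R by rewrite ltr0n.
have -> : (\sum_k cis (y k)) / #|K|%:R - ((1 - q)%:C)%C =
  (\sum_k (cis (y k) - ((1 - y k ^+ 2 / 2) +i* y k)%C)) / #|K|%:R.
  rewrite sumrB mulrBl; congr (_ - _).
  have -> : \sum_k ((1 - y k ^+ 2 / 2) +i* y k)%C = (((1 - q) * #|K|%:R)%:C)%C.
    apply/eqP; rewrite eq_complex.
    rewrite (raddf_sum (@complex.Re R)) (raddf_sum (@complex.Im R))/= ysum eqxx andbT.
    rewrite sumrB sumr_const -mulr_suml Dq.
    by apply/eqP; field; rewrite gt_eqF.
  rewrite rmorphM rmorph_nat mulfK//.
  by rewrite pnatr_eq0 -lt0n.
rewrite normc_divn ler_pdivrMr//.
apply: le_trans (normc_sum _ _ _) _.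
rewrite -[leRHS]mulrC mulr_natl -sumr_const.
apply: ler_sum => k _.
have := @normc_le (cis (y k) - ((1 - y k ^+ 2 / 2) +i* y k)%C) _ _
   (cos_approx (y k)) (sin_approx (y k)).
move=> /le_trans; apply.
have : `|y k| ^+ 3 <= w ^+ 3 by rewrite lerXn2r// ?nnegrE.
have : `|y k| ^+ 4 <= w ^+ 4 by rewrite lerXn2r// ?nnegrE.
have : w ^+ 4 <= w ^+ 3 by rewrite ler_wiXn2l.
have : 0 <= w ^+ 3 by rewrite exprn_ge0.
lra.
Qed.

Lemma normc_expX_sub1 z (d : R) (n : nat) : normc (z - 1) <= d ->
  normc (z ^+ n - 1) <= expR (n%:R * d) - 1.
Proof.
move=> zd; have d0 : 0 <= d by apply: le_trans zd; exact: normc_ge0.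
(* With z = 1 + (z - 1), induction gives the bound in terms of [1 + d], which is at most
   [expR d]. *)
suff : normc (z ^+ n - 1) <= (1 + d) ^+ n - 1.
  move/le_trans; apply; rewrite lerD2r expRM_natl.
  by rewrite lerXn2r ?nnegrE ?expR_ge0 ?expR_ge1Dx// addr_ge0.
elim: n => [|n IH]; first by rewrite !expr0 subrr normc0 subrr.
have -> : z ^+ n.+1 - 1 = (z ^+ n - 1) * z + (z - 1) by rewrite exprSr; ring.
have -> : (1 + d) ^+ n.+1 - 1 = ((1 + d) ^+ n - 1) * (1 + d) + d by rewrite exprSr; ring.
apply: le_trans (le_normcD _ _) _; apply: lerD => //; rewrite normcM.
apply: ler_pM; rewrite ?normc_ge0//.
have -> : z = 1 + (z - 1) by ring.
by apply: le_trans (le_normcD _ _) _; rewrite normc1 lerD2l.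
Qed.

Lemma expRN_approx (q : R) : 0 <= q -> `|expR (- q) - (1 - q)| <= q ^+ 2.
Proof.
move=> q0; have h1 := expR_ge1Dx (- q); have h2 := expR_ge1Dx q.
rewrite ger0_norm; last by lra.
have : expR (- q) <= (1 + q)^-1.
  by rewrite expRN lef_pV2 ?posrE ?expR_gt0//; lra.
move/le_trans => h; rewrite lerBlDr; apply: h.
rewrite -div1r ler_pdivrMr; last by lra.
have := exprn_ge0 3 q0.
rewrite !exprS !expr0; lra.
Qed.

(** The quotient of z by [expR (- q)] is within [4 * w ^+ 3] of 1, so its n-th power is within
    [expR (4 * n%:R * w ^+ 3) - 1] of 1. The real part of that power is then multiplied back by
    [expR (- (n%:R * q))]. *)
Lemma Re_pow_approx z (q w : R) (n : nat) : 0 <= w <= 1 -> 0 <= q <= w ^+ 2 / 2 ->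
  normc (z - ((1 - q)%:C)%C) <= w ^+ 3 ->
  (2 - expR (4 * n%:R * w ^+ 3)) * expR (- (n%:R * q)) <= complex.Re (z ^+ n).
Proof.
move=> /andP[w0 w1] /andP[q0 qw] zq.
have w21 : w ^+ 2 <= 1 by rewrite expr_le1.
have e0 : expR (- q) != 0 by rewrite gt_eqF ?expR_gt0.
have e2 : expR q <= 2.
  have := expR_ge1Dx (- q); rewrite expRN -div1r ler_pdivlMr ?expR_gt0//.
  have := expR_gt0 q; nra.
have ze : normc (z - (expR (- q))%:C%C) <= 2 * w ^+ 3.
  have -> : z - (expR (- q))%:C%C = (z - (1 - q)%:C%C) + ((1 - q) - expR (- q))%:C%C.
    by rewrite rmorphB; ring.
  apply: le_trans (le_normcD _ _) _; rewrite normc_real distrC.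
  have := expRN_approx q0; have : q ^+ 2 <= w ^+ 3.
    apply: le_trans (_ : (w ^+ 2 / 2) ^+ 2 <= _).
      by rewrite lerXn2r// ?nnegrE// divr_ge0// exprn_ge0.
    have : w ^+ 4 <= w ^+ 3 by rewrite ler_wiXn2l.
    have := exprn_ge0 4 w0; rewrite (_ : (w ^+ 2 / 2) ^+ 2 = w ^+ 4 / 4); [lra|by field].
  lra.
have h : normc ((z * (expR q)%:C%C) ^+ n - 1) <= expR (n%:R * (4 * w ^+ 3)) - 1.
  apply: normc_expX_sub1.
  have -> : z * (expR q)%:C%C - 1 = (z - (expR (- q))%:C%C) * (expR q)%:C%C.
    by rewrite mulrBl -rmorphM/= -expRD addNr expR0.
  rewrite normcM normc_real ger0_norm ?expR_ge0//.
  have := normc_ge0 (z - (expR (- q))%:C%C); have := expR_ge0 q; nra.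
rewrite exprMn -rmorphXn/= -expRM_natl in h.
have hR := le_trans (Re_le_normc _) h.
have E : complex.Re (z ^+ n * (expR (n%:R * q))%:C%C - 1) =
   complex.Re (z ^+ n) * expR (n%:R * q) - 1.
  by case: (z ^+ n) => a b /=; rewrite !mulr0 subr0.
rewrite {}E ler_norml in hR; case/andP: hR => hR _.
rewrite expRN ler_pdivrMr ?expR_gt0//.
rewrite -mulrA (mulrCA 4); lra.
Qed.

End Trigonometry.

(** * The cyclic group Z/N and its characters *)

Section CyclicNorm.
Variable p : nat.
Local Notation N := p.+1.
Implicit Types (a b t : 'I_p.+1).

(** The representative modulo N of least absolute value, so that [cnorm] is the distance to 0 in the
    cyclic group. *)
Definition srep a : int :=
  if (2 * a <= N)%N then a%:Z else a%:Z - N%:Z.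

Definition cnorm a : nat := `|srep a|%N.

Lemma srepE a : exists k : int, srep a = a%:Z + k * N%:Z.
Proof. by rewrite /srep; case: ifP => _; [exists 0|exists (-1)]; lia. Qed.

Lemma cnorm_half a : (2 * cnorm a <= N)%N.
Proof. by rewrite /cnorm /srep; have := ltn_ord a; case: ifP; lia. Qed.

Lemma small_multiple (k : int) : (`|(k * N%:Z)%R|%N < N)%N -> k = 0.
Proof. by rewrite abszM => h; apply/eqP; rewrite -absz_eq0; move: h; nia. Qed.

(** Two distinct integers in the same class differ by at least N, while [srep] is at most N / 2 in
    absolute value. The triangle inequality, the symmetry of [cnorm] and [near_torsion] all rest on
    this minimality. *)
Lemma cnorm_min a (z k : int) : a%:Z = z + k * N%:Z -> (cnorm a <= `|z|)%N.
Proof.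
move=> e; have [k' e'] := srepE a; have := cnorm_half a; rewrite /cnorm.
have {e e'} e : srep a = z + (k + k') * N%:Z by rewrite e' e; ring.
have [k0|k0] := eqVneq (k + k') 0; first by rewrite e k0; lia.
have := @small_multiple (k + k').
have : (`|((k + k') * N%:Z)%R|%N < N)%N = false.
  by apply/negP => /small_multiple /eqP; rewrite (negbTE k0).
by rewrite e; move: ((k + k') * N%:Z) => u; lia.
Qed.

Lemma ordD_int a b : exists k : int, (a + b)%R%:Z = a%:Z + b%:Z + k * N%:Z.
Proof.
exists (- ((a + b) %/ N)%N%:Z) => /=.
have := divn_eq (a + b) N; lia.
Qed.

Lemma cnormD a b : (cnorm (a + b)%R <= cnorm a + cnorm b)%N.
Proof.
have [k e] := ordD_int a b; have [k1 e1] := srepE a; have [k2 e2] := srepE b.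
apply: leq_trans (_ : `|(srep a + srep b)%R|%N <= _)%N; last by rewrite /cnorm; lia.
by apply: (@cnorm_min _ _ (k - k1 - k2)); rewrite e e1 e2; ring.
Qed.

Lemma cnorm0 : cnorm 0 = 0%N.
Proof. by rewrite /cnorm /srep. Qed.

Lemma cnorm_eq0 a : cnorm a = 0%N -> a = 0%R.
Proof.
by move=> h; apply/val_inj => /=; move: h; rewrite /cnorm /srep;
  have := ltn_ord a; case: ifP; lia.
Qed.

Lemma cnormN a : cnorm (- a)%R = cnorm a.
Proof.
have le b : (cnorm (- b)%R <= cnorm b)%N.
  have [k1 e1] := srepE b; have [k e] := ordD_int (- b) b.
  rewrite addNr in e.
  rewrite {2}/cnorm -abszN.
  by apply: (@cnorm_min _ _ (k1 - k)); move: e; rewrite e1/=; lia.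
by apply/eqP; rewrite eqn_leq le -{1}(opprK a) le.
Qed.

Lemma cnormB a b : (cnorm (a - b)%R <= cnorm a + cnorm b)%N.
Proof. by rewrite -(cnormN b) cnormD. Qed.

Lemma cnorm_sum (I : finType) (F : I -> 'I_p.+1) r :
  (forall i, cnorm (F i) <= r)%N -> (cnorm (\sum_i F i)%R <= #|I| * r)%N.
Proof.
move=> h; rewrite cardT -sum1_size big_distrl/= big_enum_cond/=.
elim/big_ind2 : _ => [||].
- by rewrite cnorm0.
- by move=> x1 x2 y1 y2 h1 h2; apply: leq_trans (cnormD _ _) (leq_add h1 h2).
- by move=> i _; rewrite mul1n.
Qed.

Lemma sum_srep (I : finType) (F : I -> 'I_p.+1) :
  exists k : int, \sum_i srep (F i) = ((\sum_i F i)%R : 'I_p.+1)%:Z + k * N%:Z.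
Proof.
elim: (index_enum I) => [|i r [k e]]; first by rewrite !big_nil; exists 0.
have [k1 e1] := srepE (F i).
have [k2 e2] : exists k2 : int, ((\sum_(j <- i :: r) F j)%R : 'I_p.+1)%:Z =
    (F i)%:Z + ((\sum_(j <- r) F j)%R : 'I_p.+1)%:Z + k2 * N%:Z.
  by rewrite big_cons; exact: ordD_int.
by exists (k + k1 - k2); rewrite [LHS]big_cons e e1 e2; ring.
Qed.

(** For small entries a zero sum modulo N lifts to a zero sum of integers, since that sum is a
    multiple of N smaller than N. This is what makes the first-order terms of [Phi] vanish. *)
Lemma sum_srep0 (I : finType) (F : I -> 'I_p.+1) s :
  (forall i, cnorm (F i) <= s)%N -> (#|I| * s < N)%N -> \sum_i F i = 0 ->
  \sum_i srep (F i) = 0.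
Proof.
move=> h hs F0; have [k] := sum_srep F; rewrite F0 add0r => e.
rewrite e (@small_multiple k) ?mul0r// -e.
apply: leq_ltn_trans hs.
rewrite cardT -sum1_size big_distrl/= big_enum_cond/=.
elim/big_ind2 : _ => // [x1 x2 y1 y2 h1 h2|i _]; first by lia.
by rewrite mul1n; exact: h.
Qed.

Lemma card_cnorm_le k : (#|[pred a | cnorm a <= k]|%N <= (2 * k).+1)%N.
Proof.
pose f a : 'I_(2 * k).+1 := inord `|(srep a + k%:Z)%R|%N.
rewrite -[leqRHS]card_ord; apply: (@leq_trans #|[seq f a | a in [pred a | cnorm a <= k]]|%N).
  rewrite card_in_image// => a b; rewrite !inE => ha hb.
  move/(congr1 val); rewrite /= !inordK; [|by move: ha hb; rewrite /cnorm; lia..].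
  move=> e; apply/val_inj => /=; move: ha hb e; rewrite /cnorm /srep.
  have := ltn_ord a; have := ltn_ord b; case: ifP; case: ifP; lia.
exact: max_card.
Qed.

(* For N = nu m, the points of Z/N killed by nu are the multiples of m. *)
Lemma near_torsion (nu m r : nat) t : N = (nu * m)%N ->
  (cnorm (t *+ nu)%R <= nu * r)%N ->
  exists j : 'I_nu, (cnorm (t - inord (j * m)%N)%R <= r)%N.
Proof.
move=> eN h; have nu0 : (0 < nu)%N by lia.
have m0 : (0 < m)%N by lia.
have tN := ltn_ord t.
have eZ : N%:Z = nu%:Z * m%:Z by rewrite eN.
have tn : exists k : int, ((t *+ nu)%R : 'I_p.+1)%:Z = nu%:Z * t%:Z + k * N%:Z.
  elim: (nu) => [|n [k e]]; first by exists 0; rewrite mulr0n !mul0r.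
  have [k' e'] := ordD_int t (t *+ n); exists (k + k').
  by rewrite mulrS e' e (intS n); ring.
have [k1 e1] := tn; have [k2 e2] := srepE (t *+ nu).
(* Since N = nu m, this representative is nu times an integer z congruent to t modulo m, whence |z|
   <= r. The multiple of m separating t from z, with its coefficient reduced modulo nu, gives j. *)
have E : srep (t *+ nu) = nu%:Z * (t%:Z + (k1 + k2) * m%:Z).
  by rewrite e2 e1 eZ; ring.
set z := t%:Z + _ in E.
have zr : (`|z| <= r)%N by move: h; rewrite /cnorm E abszM leq_pmul2l.
pose j := `|((- (k1 + k2))%R %% nu%:Z)%Z|%N.
have jE : j%:Z = ((- (k1 + k2)) %% nu%:Z)%Z by rewrite /j gez0_abs// modz_ge0; lia.
have jlt : (j < nu)%N by have := ltz_pmod (- (k1 + k2)) (_ : 0 < nu%:Z); lia.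
exists (Ordinal jlt) => /=.
apply: leq_trans zr.
have [k3 e3] := ordD_int (t - inord (j * m)%N) (inord (j * m)%N).
rewrite subrK inordK in e3; last by rewrite eN ltn_mul2r; lia.
have := divz_eq (- (k1 + k2)) nu%:Z; rewrite -jE => ej.
apply: (@cnorm_min _ _ (((- (k1 + k2)) %/ nu%:Z)%Z - k3)).
have -> : ((t - inord (j * m)%N)%R : 'I_p.+1)%:Z = t%:Z - j%:Z * m%:Z - k3 * N%:Z.
  by rewrite e3 PoszM; ring.
rewrite /z eZ.
have -> : j%:Z = - (k1 + k2) - ((- (k1 + k2)) %/ nu%:Z)%Z * nu%:Z by rewrite [X in X - _]ej; ring.
ring.
Qed.

End CyclicNorm.

(** * Characters of Z/N *)

Section Characters.
Variables (R : realType) (p : nat).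
Local Notation N := p.+1.
Implicit Types (a b : 'I_p.+1).

Definition unit_angle : R := pi *+ 2 / N%:R.

Definition chi a : R[i] := cis unit_angle ^+ (a : nat).

Lemma cis_unit_angle : cis unit_angle ^+ N = 1.
Proof. by rewrite -cis_natmul -mulr_natr divfK ?pnatr_eq0// cis_period. Qed.

Lemma chiD a b : chi (a + b) = chi a * chi b.
Proof. by rewrite /chi -exprD/= expr_mod// cis_unit_angle. Qed.

Lemma chi0 : chi 0 = 1.
Proof. by rewrite /chi expr0. Qed.

Lemma chiMn a k : chi (a *+ k) = chi a ^+ k.
Proof. by elim: k => [|k IH]; rewrite ?mulr0n ?chi0// mulrS chiD IH exprS. Qed.

Lemma chi_sum (I : finType) (Q : pred I) (F : I -> 'I_p.+1) :
  chi (\sum_(i | Q i) F i) = \prod_(i | Q i) chi (F i).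
Proof. exact: (big_morph chi chiD chi0). Qed.

Lemma chi_srep a : chi a = cis (unit_angle * (srep a)%:~R).
Proof.
rewrite /chi -cis_natmul /srep; case: ifP => _; first by rewrite mulr_natr.
rewrite rmorphB/= mulrBr cisD -[LHS]mulr1 mulr_natr; congr (_ * _).
have := cisN (unit_angle * N%:R); rewrite mulr_natr cis_natmul cis_unit_angle.
by rewrite mulr1 => ->.
Qed.

Lemma unit_angle_gt0 : 0 < unit_angle.
Proof. by rewrite divr_gt0// mulrn_wgt0// pi_gt0. Qed.

Lemma norm_angle_srep a : `|unit_angle * (srep a)%:~R| = unit_angle * (cnorm a)%:R.
Proof.
by rewrite normrM gtr0_norm ?unit_angle_gt0// -intr_norm /cnorm natr_absz.
Qed.

Lemma angle_srep_le4 a : `|unit_angle * (srep a)%:~R| <= 4.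
Proof.
rewrite norm_angle_srep /unit_angle.
have h := cnorm_half a; have : (2 * cnorm a)%:R <= N%:R :> R by rewrite ler_nat.
rewrite natrM => h2; rewrite mulrAC ler_pdivrMr ?ltr0n//.
have p2 := pihalf_lt2 R; have p0 := pi_gt0 R.
have : 0 <= (4 - pi) * N%:R :> R by rewrite mulr_ge0// subr_ge0; lra.
have : 0 <= pi * (N%:R - 2 * (cnorm a)%:R) :> R.
  by rewrite mulr_ge0 ?subr_ge0// ltW.
by rewrite mulr2n; lra.
Qed.

Lemma chi_neq1 a : a != 0 -> chi a != 1.
Proof.
apply: contraNN => /eqP h; apply/eqP/cnorm_eq0/eqP.
have := normc_1Bcis (angle_srep_le4 a); rewrite -chi_srep h subrr normc0.
rewrite norm_angle_srep => h2; have := unit_angle_gt0.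
have : (0 : R) <= (cnorm a)%:R by [].
move=> h3 h4; rewrite -(pnatr_eq0 R) eq_le h3 andbT.
by rewrite -(ler_pM2l h4) mulr0; lra.
Qed.

End Characters.

(** * Counting by Fourier inversion *)

Section FourierCount.
Variables (R : realType) (nu p : nat).
Local Notation N := p.+1.
Local Notation G := 'I_p.+1.
Local Notation freq := {ffun 'I_nu -> 'I_p.+1}.
Implicit Types (th et : freq).

Definition zero_sum : pred freq := fun th => \sum_a th a == 0.

Definition phase_sum th (x : nat) : R[i] := \sum_a chi R (th a) ^+ x.

(** The fibres of s are the classes. Empty fibres are allowed here; [num_perfect_partitionsE] shows
    that they do not occur for positive x. *)
Definition balanced (n : nat) (x : 'I_n -> nat) (s : {ffun 'I_n -> 'I_nu}) :=
  [forall a, forall b, \sum_(j | s j == a) x j == \sum_(j | s j == b) x j]%N.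

Definition num_balanced (n : nat) (x : 'I_n -> nat) : nat :=
  #|[pred s : {ffun 'I_n -> 'I_nu} | balanced x s]|.

Lemma zero_sum0 : zero_sum 0.
Proof. by rewrite /zero_sum big1// => a _; rewrite ffunE. Qed.

Lemma zero_sumD th d : zero_sum d -> zero_sum (th + d) = zero_sum th.
Proof.
move=> /eqP d0; rewrite /zero_sum.
under eq_bigr do rewrite ffunE.
by rewrite big_split/= d0 addr0.
Qed.

Lemma prod_chi th (y : 'I_nu -> nat) :
  \prod_a chi R (th a) ^+ y a = chi R (\sum_a th a *+ y a).
Proof. by rewrite chi_sum; apply: eq_bigr => a _; rewrite chiMn. Qed.

(** For constant y every term is the character at a multiple of the zero sum. Otherwise, translation
    by [d], which is 1 at a and -1 at b, preserves the zero-sum frequencies and multiplies the sum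
    by a character value other than 1, so the sum vanishes. *)
Lemma orthogonality (y : 'I_nu -> nat) : (forall a, y a < N)%N ->
  \sum_(th | zero_sum th) \prod_a chi R (th a) ^+ y a =
  #|zero_sum|%:R * [forall a, forall b, y a == y b]%:R.
Proof.
move=> yN; under eq_bigr do rewrite prod_chi.
have [/forallP h|] := boolP [forall a, forall b, y a == y b].
  rewrite mulr1 -sumr_const; apply: eq_bigr => th /eqP th0.
  case: (pickP 'I_nu) => [a0 _|none]; last first.
    by rewrite big1 ?chi0// => a; have := none a.
  under eq_bigr => a _.
    have /forallP/(_ a0)/eqP -> := h a; over.
  by rewrite sumrMnl th0 mul0rn chi0.
rewrite negb_forall => /existsP[a]; rewrite negb_forall => /existsP[b yab].
rewrite mulr0.
pose g : G := inord 1.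
pose d : freq := [ffun c => g *+ (c == a) - g *+ (c == b)].
(* For N = 1 the element [inord 1] would be 0; but then all [y a] vanish, against [yab]. *)
have gE k : (k < N)%N -> (g *+ k : G) = k :> nat.
  move=> kN; have p0 : (0 < p)%N.
    rewrite lt0n; apply: contraNneq yab => p0; have := yN a; have := yN b.
    by rewrite !ltnS p0 !leqn0 => /eqP -> /eqP ->.
  rewrite Zp_mulrn /= /g inordK//.
  by rewrite mul1n modn_small.
have dsum (z : 'I_nu -> nat) : \sum_c d c *+ z c = g *+ z a - g *+ z b.
  under eq_bigr do rewrite ffunE mulrnBl -!mulrnA.
  rewrite sumrB; congr (_ - _); [rewrite (bigD1 a)|rewrite (bigD1 b)] => //=;
    rewrite eqxx mul1n big1 ?addr0// => c /negbTE ->; by rewrite mul0n mulr0n.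
have d0 : zero_sum d.
  have := dsum (fun=> 1%N); rewrite /= !mulr1n subrr /zero_sum => {2}<-.
  by apply/eqP; apply: eq_bigr => c _; rewrite mulr1n.
set T := LHS.
have : T = chi R (g *+ y a - g *+ y b) * T.
  rewrite {1}/T (reindex_inj (addIr d))/= mulr_sumr.
  apply: eq_big => [th|th _]; first by rewrite zero_sumD.
  rewrite -chiD; congr (chi R _); rewrite -dsum -big_split/=.
  by apply: eq_bigr => c _; rewrite ffunE mulrnDl addrC.
move/eqP; rewrite -subr_eq0 -{1}(mul1r T) -mulrBl mulf_eq0 => /orP[|/eqP//].
rewrite subr_eq0 eq_sym => /idPn[]; apply: chi_neq1.
by rewrite subr_eq0; apply: contraNneq yab => /(congr1 val)/=; rewrite !gE// => ->.
Qed.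

Lemma prod_phase_sum (n : nat) (x : 'I_n -> nat) th :
  \prod_j phase_sum th (x j) =
  \sum_(s : {ffun 'I_n -> 'I_nu})
    \prod_a chi R (th a) ^+ (\sum_(j | s j == a) x j)%N.
Proof.
rewrite bigA_distr_bigA/=; apply: eq_bigr => s _.
rewrite (partition_big s predT)//=; apply: eq_bigr => a _.
rewrite expr_sum; apply: eq_bigr => j /eqP -> //.
Qed.

(** Expanding the product gives one term per map s. All fibre sums are below N, so their equality
    modulo N is equality, and orthogonality applies. *)
Lemma fourier_count (n : nat) (x : 'I_n -> nat) : (\sum_j x j < N)%N ->
  \sum_(th | zero_sum th) \prod_j phase_sum th (x j) =
  #|zero_sum|%:R * (num_balanced x)%:R.
Proof.
move=> xN; under eq_bigr do rewrite prod_phase_sum.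
have -> : (num_balanced x)%:R = \sum_s (balanced x s)%:R :> R[i].
  rewrite /num_balanced -sum1_card natr_sum big_mkcond/=.
  by apply: eq_bigr => s _; rewrite inE; case: balanced.
rewrite exchange_big/= mulr_sumr.
apply: eq_bigr => s _; rewrite orthogonality; last first.
  move=> a; apply: leq_ltn_trans xN.
  by rewrite [leqRHS](bigID (fun j => s j == a))/= leq_addr.
by [].
Qed.

Lemma sum_ffun_prod (n M : nat) (F : 'I_M -> R[i]) :
  \sum_(x : {ffun 'I_n -> 'I_M}) \prod_j F (x j) = (\sum_k F k) ^+ n.
Proof.
have <- : \prod_(j < n) \sum_k F k = (\sum_k F k) ^+ n.
  by rewrite prodr_const card_ord.
by rewrite bigA_distr_bigA.
Qed.

Lemma first_moment (n M : nat) : (n * M < N)%N ->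
  (#|zero_sum| * \sum_(x : {ffun 'I_n -> 'I_M}) num_balanced (fun j => (x j).+1))%:R
  = \sum_(th | zero_sum th) (\sum_(k < M) phase_sum th k.+1) ^+ n.
Proof.
move=> nM; rewrite natrM natr_sum mulr_sumr.
under [RHS]eq_bigr do rewrite -sum_ffun_prod.
rewrite exchange_big/=; apply: eq_bigr => x _; rewrite fourier_count//.
apply: leq_ltn_trans nM; rewrite -[X in (_ <= X * _)%N]card_ord -sum_nat_const.
by apply: leq_sum => j _.
Qed.

Lemma second_moment (n M : nat) : (n * M < N)%N ->
  (#|zero_sum| ^ 2 *
   \sum_(x : {ffun 'I_n -> 'I_M}) num_balanced (fun j => (x j).+1) ^ 2)%:R
  = \sum_(th | zero_sum th) \sum_(et | zero_sum et)
      (\sum_(k < M) phase_sum th k.+1 * phase_sum et k.+1) ^+ n.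
Proof.
move=> nM; rewrite natrM natr_sum mulr_sumr.
under [RHS]eq_bigr do under eq_bigr do rewrite -sum_ffun_prod.
under [RHS]eq_bigr do rewrite exchange_big/=.
rewrite exchange_big/=; apply: eq_bigr => x _.
rewrite -natrM -expnMn natrX natrM -fourier_count; last first.
  apply: leq_ltn_trans nM; rewrite -[X in (_ <= X * _)%N]card_ord -sum_nat_const.
  by apply: leq_sum => j _.
rewrite expr2 mulr_suml; apply: eq_bigr => th _; rewrite mulr_sumr.
by apply: eq_bigr => et _; rewrite big_split.
Qed.

End FourierCount.

(** A partition corresponds to the map sending each index to its class. Conversely the fibres of a
    balanced map are non-empty: as n > 0 and x > 0, one fibre has a positive sum, hence all have. *)
Lemma num_perfect_partitionsE (nu n : nat) (x : 'I_n -> nat) :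
  (0 < n)%N -> (forall j, 0 < x j)%N ->
  num_perfect_partitions nu x = num_balanced nu x.
Proof.
move=> n0 x0; rewrite /num_perfect_partitions /num_balanced.
pose f (s : {ffun 'I_n -> 'I_nu}) : {ffun 'I_nu -> {set 'I_n}} :=
  [ffun a => finset (fun j => s j == a)].
have fi : injective f.
  move=> s t /ffunP e; apply/ffunP => j; apply/eqP; rewrite eq_sym.
  by have := e (s j); rewrite !ffunE => /setP/(_ j); rewrite !inE eqxx => <-.
have fE s a : \sum_(j in f s a) x j = \sum_(j | s j == a) x j.
  by apply: eq_bigl => j; rewrite ffunE inE.
rewrite -(fintype.card_image fi); apply: eq_card => S; rewrite !inE.
apply/idP/fintype.imageP => [/andP[/and3P[_ /forallP dis /eqP cov] perf]|[s bal ->]].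
  have ex j : {a | j \in S a}.
    have : j \in [set: 'I_n]%SET by rewrite inE.
    by rewrite -cov => /finset.bigcupP h; apply: sigW; case: h => a _ ja; exists a.
  pose s : {ffun 'I_n -> 'I_nu} := [ffun j => sval (ex j)].
  have SE : S = f s.
    apply/ffunP => a; apply/setP => j; rewrite ffunE inE ffunE.
    case: (ex j) => b jb /=; apply/idP/eqP => [ja|<-//].
    apply/eqP; apply: contraT => ba.
    have /forallP/(_ b) := dis a; rewrite eq_sym ba/= => /pred0P/(_ j)/=.
    by rewrite ja jb.
  exists s => //; rewrite inE; apply/forallP => a; apply/forallP => b.
  by rewrite -!fE -SE; move/forallP/(_ a)/forallP: perf; apply.
move: bal; rewrite inE => /forallP bal; apply/andP; split; last first.
  by apply/forallP => a; apply/forallP => b; rewrite !fE; exact: (forallP (bal a)).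
apply/and3P; split.
- apply/forallP => a; apply/set0Pn.
  pose j0 : 'I_n := Ordinal n0.
  have /forallP/(_ (s j0))/eqP e := bal a.
  case: (pickP (fun j => s j == a)) => [j ja|none]; first by exists j; rewrite ffunE inE.
  move: e; rewrite big_pred0// (bigD1 j0)//= => /esym/eqP.
  by rewrite addn_eq0; have := x0 j0; case: (x j0).
- apply/forallP => a; apply/forallP => b; apply/implyP => ab.
  apply/pred0P => j /=; rewrite !ffunE !inE.
  by apply/negbTE; apply: contra ab => /andP[/eqP <- /eqP <-].
- apply/eqP/setP => j; rewrite inE; apply/finset.bigcupP; exists (s j) => //.
  by rewrite ffunE inE.
Qed.

(** * Bounds on Phi *)

Section PhiBounds.
Variables (R : realType) (nu n M p : nat).
Local Notation N := p.+1.
Local Notation G := 'I_p.+1.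
Local Notation freq := {ffun 'I_nu -> 'I_p.+1}.
Implicit Types (th et : freq) (c : G).

Hypothesis nu2 : (2 <= nu)%N.
Hypothesis n_gt0 : (0 < n)%N.
Hypothesis M4 : (4 <= M)%N.
Hypothesis NE : N = (nu * (n * M))%N.

Local Notation ang := (fun c : 'I_p.+1 => unit_angle R p * (srep c)%:~R).
Local Notation u := (unit_angle R p).

(* The scale on which char_fun varies: its argument M t equals, up to sign,
   lam * cnorm c for t = ang c. *)
Local Notation lam := (M%:R * unit_angle R p).

Definition Phi th et : R[i] :=
  (\sum_(k < M) phase_sum R th k.+1 * phase_sum R et k.+1) / (M * nu ^ 2)%:R.

Definition char_norm c : R := normc (char_fun M (ang c)).

Lemma lamE : lam = 2 * pi / (nu * n)%:R.
Proof.
rewrite /unit_angle NE !natrM mulr2n; field.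
by rewrite !pnatr_eq0 -!lt0n n_gt0 !(leq_trans _ nu2, leq_trans _ M4).
Qed.

Lemma lam_gt0 : 0 < lam.
Proof. by rewrite mulr_gt0 ?unit_angle_gt0// ltr0n; lia. Qed.

Lemma phase_sumM th et (x : nat) : phase_sum R th x * phase_sum R et x =
  \sum_(ab : 'I_nu * 'I_nu) chi R (th ab.1 + et ab.2) ^+ x.
Proof.
rewrite /phase_sum mulr_suml.
under eq_bigr do rewrite mulr_sumr.
by rewrite pair_big/=; apply: eq_bigr => -[a b] _ /=; rewrite chiD exprMn.
Qed.

Lemma PhiE th et : Phi th et =
  (\sum_(ab : 'I_nu * 'I_nu) char_fun M (ang (th ab.1 + et ab.2))) / (nu ^ 2)%:R.
Proof.
rewrite /Phi /char_fun -mulr_suml natrM invfM mulrA; congr (_ / _ / _).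
rewrite exchange_big/=; apply: eq_bigr => k _; rewrite phase_sumM.
by apply: eq_bigr => ab _; rewrite chi_srep cis_natmul.
Qed.

Lemma normc_Phi_le th et :
  normc (Phi th et) <= (\sum_(ab : 'I_nu * 'I_nu) char_norm (th ab.1 + et ab.2)) / (nu ^ 2)%:R.
Proof.
rewrite PhiE normc_divn ler_pM2r ?normc_sum//.
by rewrite invr_gt0 ltr0n expn_gt0; lia.
Qed.

Lemma char_norm_le1 c : char_norm c <= 1.
Proof. exact: char_fun_le1. Qed.

Lemma nu_sq_gt0 : 0 < (nu ^ 2)%:R :> R.
Proof. by rewrite ltr0n expn_gt0; lia. Qed.

Lemma card_pairs : #|{: 'I_nu * 'I_nu}|%:R = (nu ^ 2)%:R :> R.
Proof. by rewrite card_prod !card_ord mulnn. Qed.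

Lemma Phi_gap1 th et (g : R) ab : char_norm (th ab.1 + et ab.2) <= 1 - g ->
  normc (Phi th et) <= 1 - g / (nu ^ 2)%:R.
Proof.
move=> h; apply: le_trans (normc_Phi_le _ _) _.
rewrite ler_pdivrMr ?nu_sq_gt0// mulrBl mul1r divfK ?gt_eqF ?nu_sq_gt0//.
have -> : (nu ^ 2)%:R = 1 + \sum_(i : 'I_nu * 'I_nu | i != ab) 1 :> R.
  by rewrite -card_pairs -sum1_card natr_sum (bigD1 ab).
rewrite (bigD1 ab)//= addrAC.
by apply: lerD => //; apply: ler_sum => i _; exact: char_norm_le1.
Qed.

(** Two deficient pairs double the loss; this factor 2 is the one in the base 1 - 2 / nu^2 of the
    threshold. *)
Lemma Phi_gap2 th et (g : R) ab ab' : ab' != ab ->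
  char_norm (th ab.1 + et ab.2) <= 1 - g -> char_norm (th ab'.1 + et ab'.2) <= 1 - g ->
  normc (Phi th et) <= 1 - 2 * g / (nu ^ 2)%:R.
Proof.
move=> ne h h'; apply: le_trans (normc_Phi_le _ _) _.
rewrite ler_pdivrMr ?nu_sq_gt0// mulrBl mul1r divfK ?gt_eqF ?nu_sq_gt0//.
have -> : (nu ^ 2)%:R =
    1 + (1 + \sum_(i : 'I_nu * 'I_nu | (i != ab) && (i != ab')) 1) :> R.
  by rewrite -card_pairs -sum1_card natr_sum (bigD1 ab)//= (bigD1 ab').
rewrite (bigD1 ab)//= (bigD1 ab')//=.
set A := \sum_(i | _) char_norm _; set B := \sum_(i | _) _.
have : A <= B by apply: ler_sum => i _; exact: char_norm_le1.
lra.
Qed.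

Lemma norm_ang c : M%:R * `|ang c| = lam * (cnorm c)%:R.
Proof. by rewrite /= norm_angle_srep mulrA. Qed.

Lemma char_norm_mid c (s : nat) : (s < cnorm c)%N -> lam * s%:R <= 1 ->
  char_norm c <= 1 - (lam * s%:R) ^+ 2 / (200 * 100).
Proof.
move=> sc l1; apply: char_fun_gap => //; first exact: angle_srep_le4.
  by rewrite l1 mulr_ge0// ltW// lam_gt0.
by rewrite norm_ang ler_pM2l ?lam_gt0// ler_nat ltnW.
Qed.

Lemma char_norm_far c (r : nat) : (0 < r)%N -> (r < cnorm c)%N ->
  char_norm c <= 6 / (lam * r%:R).
Proof.
move=> r0 rc; have M0 : (0 < M)%N by lia.
have c0 : (0 < cnorm c)%N by apply: leq_trans rc.
have t0 : ang c != 0 by rewrite -normr_gt0 /= norm_angle_srep mulr_gt0 ?unit_angle_gt0 ?ltr0n.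
apply: le_trans (char_fun_decay M0 (angle_srep_le4 R c) t0) _.
rewrite norm_ang; apply: ler_wpM2l => //.
have l0 := lam_gt0.
rewrite lef_pV2 ?posrE; [|by rewrite mulr_gt0 ?l0 ?ltr0n..].
by rewrite ler_pM2l// ler_nat ltnW.
Qed.

(** In a rectangle with corners (a, b), (a, b'), (a', b), (a', b'), the sum at one corner is a
    signed combination of the sums at the other three. If it exceeds 3 r, one of those exceeds r. *)
Lemma two_far th et (r : nat) a b : (3 * r < cnorm (th a + et b)%R)%N ->
  exists ab : 'I_nu * 'I_nu, exists ab' : 'I_nu * 'I_nu,
  [/\ ab' != ab, (r < cnorm (th ab.1 + et ab.2)%R)%N &
      (r < cnorm (th ab'.1 + et ab'.2)%R)%N].
Proof.
move=> far.
have other (i : 'I_nu) : exists j, j != i.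
  have [i0|i0] := eqVneq (nat_of_ord i) 0%N.
    by exists (Ordinal nu2); apply/eqP => /(congr1 val) /=; lia.
  have nu0 : (0 < nu)%N by lia.
  by exists (Ordinal nu0); apply/eqP => /(congr1 val) /=; lia.
have [a' a'a] := other a; have [b' b'b] := other b.
have E : th a + et b = (th a + et b') + (th a' + et b) - (th a' + et b').
  by rewrite (addrC (th a') (et b)) addrACA (addrC (et b')) addrK.
have : (3 * r < cnorm (th a + et b')%R + cnorm (th a' + et b)%R + cnorm (th a' + et b')%R)%N.
  apply: leq_trans far _; rewrite {1}E.
  by apply: leq_trans (cnormB _ _) _; rewrite leq_add2r cnormD.
move=> big; exists (a, b) => /=.
have rab : (r < cnorm (th a + et b)%R)%N by lia.
have [h|h] := ltnP r (cnorm (th a + et b')%R).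
  by exists (a, b'); split => //; rewrite xpair_eqE (negbTE b'b) andbF.
have [h'|h'] := ltnP r (cnorm (th a' + et b)%R).
  by exists (a', b); split => //; rewrite xpair_eqE (negbTE a'a).
exists (a', b'); split => //=; first by rewrite xpair_eqE (negbTE a'a).
by lia.
Qed.

(** The bounds on |Phi| in the far and in the middle range. Taking r a multiple of n makes
    [lam * r%:R] a constant as large as desired, so that [rho] approaches 1 - 2 / nu^2. *)
Definition rho (r : nat) : R := 1 - 2 * (1 - 6 / (lam * r%:R)) / (nu ^ 2)%:R.
Definition kappa (s : nat) : R := 1 - (lam * s%:R) ^+ 2 / (200 * 100) / (nu ^ 2)%:R.

Lemma Phi_far th et (r : nat) a b : (0 < r)%N ->
  (3 * r < cnorm (th a + et b)%R)%N -> normc (Phi th et) <= rho r.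
Proof.
move=> r0 /two_far[ab [ab' [ne h h']]].
apply: (Phi_gap2 ne); rewrite opprB addrCA subrr addr0; exact: char_norm_far.
Qed.

Lemma Phi_mid th et (s : nat) a b : lam * s%:R <= 1 ->
  (s < cnorm (th a + et b)%R)%N -> normc (Phi th et) <= kappa s.
Proof.
by move=> l1 h; apply: (@Phi_gap1 _ _ _ (a, b)); exact: char_norm_mid.
Qed.

Definition freq_ball (r : nat) : pred freq :=
  fun th => zero_sum th && [forall a, cnorm (th a) <= r]%N.

(* Half of the variance of sum_a X th_a, averaged over the choice of a; the
   mean vanishes on zero-sum frequencies. *)
Definition quad th : R :=
  (\sum_(k < M) (k.+1)%:R ^+ 2) / M%:R * u ^+ 2 / (2 * nu%:R) *
  \sum_a ((srep (th a))%:~R) ^+ 2.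

(** [Phi] is the mean of [cis] over M nu^2 angles of size at most w, to which the second-order
    Taylor estimate applies. *)
Lemma Phi_near th et (s : nat) (w : R) :
  freq_ball s th -> freq_ball s et -> (nu * s < N)%N -> w = 2 * lam * s%:R -> w <= 1 ->
  normc (Phi th et - ((1 - (quad th + quad et))%:C)%C) <= w ^+ 3
  /\ 0 <= quad th + quad et <= w ^+ 2 / 2.
Proof.
move=> /andP[/eqP th0 /forallP ths] /andP[/eqP et0 /forallP ets] sN Dw w1.
pose K := ('I_M * ('I_nu * 'I_nu))%type.
(* The sum of two representatives need not be the representative of the sum, but it gives the same
   character value and is additive in th and et. *)
pose y (k : K) : R := u * ((srep (th k.2.1))%:~R + (srep (et k.2.2))%:~R) * (k.1.+1)%:R.
have cardK : #|{: K}|%:R = M%:R * (nu ^ 2)%:R :> R.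
  by rewrite !card_prod !card_ord mulnn natrM.
have K0 : (0 < #|{: K}|)%N by rewrite !card_prod !card_ord !muln_gt0; lia.
have M0 : M%:R != 0 :> R by rewrite pnatr_eq0; lia.
have nu0 : nu%:R != 0 :> R by rewrite pnatr_eq0; lia.
have s_th : \sum_a (srep (th a))%:~R = 0 :> R.
  by rewrite -raddf_sum/= (@sum_srep0 _ _ _ s)// card_ord.
have s_et : \sum_a (srep (et a))%:~R = 0 :> R.
  by rewrite -raddf_sum/= (@sum_srep0 _ _ _ s)// card_ord.
have w0 : 0 <= w by rewrite Dw mulr_ge0// mulr_ge0// ltW// lam_gt0.
have yw k : `|y k| <= w.
  rewrite /y normrM normr_nat mulrDr.
  have h1 : `|u * (srep (th k.2.1))%:~R + u * (srep (et k.2.2))%:~R| <= u * (2 * s%:R).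
    apply: le_trans (ler_normD _ _) _; rewrite !norm_angle_srep -mulrDr.
    rewrite ler_pM2l ?unit_angle_gt0// -natrD -natrM ler_nat.
    by have := ths k.2.1; have := ets k.2.2; lia.
  apply: le_trans (ler_pM (normr_ge0 _) (ler0n _ _) h1 (_ : _ <= M%:R)) _.
    by rewrite ler_nat.
  by rewrite Dw; lra.
have row (F : 'I_nu -> 'I_nu -> R) (z : 'I_M -> R) :
    \sum_(k : K) F k.2.1 k.2.2 * z k.1 = (\sum_a \sum_b F a b) * \sum_i z i.
  transitivity (\sum_i \sum_(ab : 'I_nu * 'I_nu) F ab.1 ab.2 * z i).
    by rewrite pair_big/=; apply: eq_bigr => -[].
  rewrite exchange_big/= (pair_big predT predT (fun a b => F a b))/= mulr_suml.
  by apply: eq_bigr => ab _; rewrite mulr_sumr.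
have ysum : \sum_k y k = 0.
  rewrite /y (row (fun a b => u * ((srep (th a))%:~R + (srep (et b))%:~R))
                  (fun i => (i.+1)%:R)).
  under eq_bigr do rewrite -mulr_sumr big_split/= s_et addr0 sumr_const card_ord -mulr_natr.
  by rewrite -mulr_sumr -mulr_suml s_th mul0r mulr0 mul0r.
have qE : quad th + quad et = (\sum_k y k ^+ 2) / 2 / #|{: K}|%:R.
  rewrite /y; under eq_bigr do rewrite exprMn.
  rewrite (row (fun a b => (u * ((srep (th a))%:~R + (srep (et b))%:~R)) ^+ 2)
                  (fun i => (i.+1)%:R ^+ 2)).
  (* The cross terms vanish because et sums to zero over the integers, so the variance splits into a
     part in th and a part in et. *)
  have -> : \sum_a \sum_b (u * ((srep (th a))%:~R + (srep (et b))%:~R)) ^+ 2 =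
     u ^+ 2 * (nu%:R * (\sum_a (srep (th a))%:~R ^+ 2 + \sum_a (srep (et a))%:~R ^+ 2)).
    have in1 a : \sum_b (u * ((srep (th a))%:~R + (srep (et b))%:~R)) ^+ 2 =
       u ^+ 2 * (nu%:R * (srep (th a))%:~R ^+ 2 + \sum_b (srep (et b))%:~R ^+ 2).
      transitivity (\sum_b (u ^+ 2 * (srep (th a))%:~R ^+ 2 +
          (2 * u ^+ 2 * (srep (th a))%:~R) * (srep (et b))%:~R +
          u ^+ 2 * (srep (et b))%:~R ^+ 2)); first by apply: eq_bigr => b _; ring.
      by rewrite !big_split/= -!mulr_sumr s_et mulr0 addr0 sumr_const card_ord -mulr_natr; ring.
    under eq_bigr do rewrite in1.
    by rewrite -mulr_sumr big_split/= -mulr_sumr sumr_const card_ord -mulr_natr; ring.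
  rewrite cardK /quad natrX; field.
  by rewrite M0 nu0.
split; first last.
  rewrite qE; apply/andP; split.
    by do 2 (apply: divr_ge0 => //); apply: sumr_ge0 => k _; exact: sqr_ge0.
  rewrite ler_pdivrMr ?ltr0n// mulrAC ler_pM2r ?invr_gt0//.
  rewrite mulr_natr -sumr_const; apply: ler_sum => k _.
  by rewrite -real_normK ?num_real// lerXn2r// nnegrE.
have -> : Phi th et = (\sum_k cis (y k)) / #|{: K}|%:R.
  rewrite /Phi !card_prod !card_ord mulnn; congr (_ / _).
  under eq_bigr do rewrite phase_sumM.
  rewrite pair_big/=; apply: eq_bigr => -[k [a b]] _ /=.
  by rewrite chiD !chi_srep -cisD -cis_natmul -mulrDr /y/= mulr_natr.
by apply: mean_cis_approx => //; rewrite w0.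
Qed.

End PhiBounds.

(** * Sums over frequencies *)

Section FrequencySums.
Variables (R : realType) (nu n M p : nat).
Local Notation N := p.+1.
Local Notation freq := {ffun 'I_nu -> 'I_p.+1}.
Implicit Types (th et : freq) (t : freq * freq).

Hypothesis nu2 : (2 <= nu)%N.
Hypothesis n_gt0 : (0 < n)%N.
Hypothesis M4 : (4 <= M)%N.
Hypothesis NE : N = (nu * (n * M))%N.

Local Notation lam := (M%:R * unit_angle R p).
Local Notation PhiM := (@Phi R nu M p).
Local Notation quadM := (@quad R nu M p).
Local Notation zsum := (@zero_sum nu p).
Local Notation bal := (@freq_ball nu p).

Definition freq_ball2 (r : nat) : pred (freq * freq) := fun t => bal r t.1 && bal r t.2.
Definition zero_sum2 : pred (freq * freq) := fun t => zsum t.1 && zsum t.2.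
Definition within (r : nat) : pred (freq * freq) :=
  fun t => zero_sum2 t && [forall a, forall b, cnorm (t.1 a + t.2 b)%R <= r]%N.

(* Shifting by opposite multiples of N / nu keeps both frequencies zero-sum and
   all the sums th a + et b unchanged. *)
Definition torsion (j : 'I_nu) : freq * freq :=
  let c : freq := [ffun=> inord (j * (n * M))%N] in (c, - c).

Lemma zero_sum_torsion j : zsum (torsion j).1.
Proof.
rewrite /zero_sum /=; under eq_bigr do rewrite ffunE.
have jN : (j * (n * M) < N)%N.
  by rewrite NE ltn_mul2r muln_gt0 n_gt0 ltn_ord andbT (leq_trans _ M4).
rewrite sumr_const card_ord Zp_mulrn; apply/eqP/val_inj => /=.
by rewrite inordK// mulnAC -mulnA -NE modnMl.
Qed.

Lemma zero_sumN th : zsum (- th) = zsum th.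
Proof.
rewrite /zero_sum; under eq_bigr do rewrite ffunE.
by rewrite sumrN oppr_eq0.
Qed.

Lemma Phi_torsion t j :
  PhiM (t + torsion j).1 (t + torsion j).2 = PhiM t.1 t.2.
Proof.
rewrite !PhiE; congr (_ / _); apply: eq_bigr => ab _ /=; rewrite !ffunE.
by rewrite addrACA subrr addr0.
Qed.

(** Summing [t.1 a0 + t.2 b] over b gives nu times [t.1 a0], so this coordinate is within r of a
    torsion point. The other coordinates follow by differences, at a cost of at most 3 r. *)
Lemma within_shift (r : nat) t : within r t ->
  exists j, freq_ball2 (3 * r) (t - torsion j).
Proof.
move=> /andP[/andP[z1 z2] /forallP h].
have a0 : 'I_nu by apply: (@Ordinal nu 0); lia.
have hab a b : (cnorm (t.1 a + t.2 b)%R <= r)%N by have /forallP := h a; apply.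
have [j jr] : exists j : 'I_nu, (cnorm (t.1 a0 - inord (j * (n * M))%N)%R <= r)%N.
  apply: near_torsion => //.
  have -> : t.1 a0 *+ nu = \sum_b (t.1 a0 + t.2 b).
    by rewrite big_split/= (eqP z2) addr0 sumr_const card_ord.
  by have := @cnorm_sum p 'I_nu (fun b => t.1 a0 + t.2 b) r (hab a0); rewrite card_ord.
exists j; have zt := zero_sum_torsion j.
apply/andP; split; apply/andP; split.
- by rewrite /= zero_sumD// zero_sumN.
- apply/forallP => a; rewrite /= !ffunE; set c := inord _ in jr *.
  have -> : t.1 a - c = (t.1 a + t.2 a0) - (t.1 a0 + t.2 a0) + (t.1 a0 - c).
    by rewrite (addrC (t.1 a0) (t.2 a0)) opprD !addrA addrK subrK.
  have := cnormD (t.1 a + t.2 a0 - (t.1 a0 + t.2 a0)) (t.1 a0 - c).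
  have := cnormB (t.1 a + t.2 a0) (t.1 a0 + t.2 a0).
  have := hab a a0; have := hab a0 a0; lia.
- by rewrite /= opprK zero_sumD.
- apply/forallP => b; rewrite /= !ffunE opprK; set c := inord _ in jr *.
  have -> : t.2 b + c = (t.1 a0 + t.2 b) - (t.1 a0 - c).
    by rewrite opprB (addrC (t.1 a0)) addrACA subrr addr0.
  have := cnormB (t.1 a0 + t.2 b) (t.1 a0 - c); have := hab a0 b; lia.
Qed.

(** Each pair lies in at least one of the nu translates of the ball, and F has the same sum over
    each of them. This is the source of the factor nu in the second moment. *)
Lemma sum_within (r : nat) (F : freq * freq -> R) :
  (forall t, 0 <= F t) -> (forall t j, F (t + torsion j) = F t) ->
  \sum_(t | within r t) F t <= nu%:R * \sum_(t | freq_ball2 (3 * r) t) F t.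
Proof.
move=> F0 Fj.
apply: (le_trans (_ : _ <= \sum_(t : freq * freq)
  \sum_(j | freq_ball2 (3 * r) (t - torsion j)) F t)).
  rewrite big_mkcond/=; apply: ler_sum => t _; case: ifP => [/within_shift[j hj]|_].
    by rewrite (bigD1 j)//= lerDl sumr_ge0.
  by rewrite sumr_ge0.
rewrite (exchange_big_dep predT)//=.
under eq_bigr => j _.
  rewrite (reindex_inj (addIr (torsion j)))/=.
  under eq_bigl do rewrite addrK.
  under eq_bigr do rewrite Fj.
  over.
by rewrite sumr_const card_ord mulr_natl.
Qed.

Lemma sum_ball2 (r : nat) (f g : freq -> R) :
  \sum_(t | freq_ball2 r t) f t.1 * g t.2 =
  (\sum_(th | bal r th) f th) * (\sum_(th | bal r th) g th).
Proof.
rewrite mulr_suml; under [RHS]eq_bigr do rewrite mulr_sumr.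
by rewrite pair_big.
Qed.

Definition gauss th : R := expR (- (n%:R * quadM th)).
Definition gauss_sum (r : nat) : R := \sum_(th | bal r th) gauss th.

Lemma freq_ball0 (r : nat) : bal r 0.
Proof.
apply/andP; split; first exact: zero_sum0.
by apply/forallP => a; rewrite ffunE cnorm0.
Qed.

Lemma quad0 : quadM 0 = 0.
Proof.
by rewrite /quad [X in _ * X]big1 ?mulr0// => a _; rewrite ffunE /srep/= expr0n.
Qed.

(** The frequency 0 alone contributes 1. Hence bounded error terms can be absorbed in the Gaussian
    sum. *)
Lemma gauss_sum_ge1 (r : nat) : 1 <= gauss_sum r.
Proof.
rewrite /gauss_sum (bigD1 (0 : freq)) ?freq_ball0//= {1}/gauss quad0 mulr0 oppr0 expR0.
by rewrite lerDl sumr_ge0// => th _; exact: expR_ge0.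
Qed.

Lemma normc_Phi_pow th et (c : R) :
  normc (PhiM th et) <= c -> normc (PhiM th et ^+ n) <= c ^+ n.
Proof.
move=> h; rewrite normcX lerXn2r ?nnegrE ?normc_ge0//.
by apply: le_trans h; exact: normc_ge0.
Qed.

(** Every pair obeys one of the near, middle and far bounds. The ranges of the three sums overlap,
    which only increases the right-hand side. *)
Lemma second_moment_bound (s r : nat) (w : R) : (0 < r)%N ->
  (nu * (3 * s) < N)%N -> w = 2 * lam * (3 * s)%:R -> w <= 1 ->
  0 <= rho R nu M p r -> 0 <= kappa R nu M p s ->
  \sum_(t | zero_sum2 t) normc (PhiM t.1 t.2 ^+ n) <=
  nu%:R * (expR (n%:R * w ^+ 3) * gauss_sum (3 * s) ^+ 2)
  + nu%:R * (#|bal (9 * r)|%:R ^+ 2 * kappa R nu M p s ^+ n)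
  + #|zsum|%:R ^+ 2 * rho R nu M p r ^+ n.
Proof.
move=> r0 sN Dw w1 rho0 kap0.
set K := kappa _ _ _ _ _ in kap0 *; set Q := rho _ _ _ _ _ in rho0 *.
have l0 := lam_gt0 R nu2 n_gt0 M4 NE.
have ls : lam * s%:R <= 1.
  apply: le_trans w1; rewrite Dw natrM; have : 0 <= lam * s%:R by rewrite mulr_ge0// ltW.
  lra.
pose E t := normc (PhiM t.1 t.2 ^+ n).
have E0 t : 0 <= E t by exact: normc_ge0.
apply: (le_trans (_ : _ <= \sum_(t | within s t) E t +
  \sum_(t | within (3 * r) t) K ^+ n + \sum_(t | zero_sum2 t) Q ^+ n)).
  rewrite big_mkcond [X in X + _ + _]big_mkcond [X in _ + X + _]big_mkcond.
  rewrite [X in _ + _ + X]big_mkcond -!big_split/=.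
  apply: ler_sum => t _; rewrite /within.
  have [z|_] := boolP (zero_sum2 t); rewrite ?andTb ?andFb; last by rewrite !addr0.
  case: ifPn => [_|].
    rewrite -addrA lerDl addr_ge0// ?exprn_ge0//.
    by case: ifP => // _; rewrite exprn_ge0.
  rewrite negb_forall => /existsP[a]; rewrite negb_forall => /existsP[b].
  rewrite -ltnNge => sab; rewrite add0r.
  case: ifPn => [_|].
    rewrite ler_wpDr ?exprn_ge0//; apply: normc_Phi_pow.
    exact: (Phi_mid nu2 n_gt0 M4 NE ls sab).
  rewrite negb_forall => /existsP[a']; rewrite negb_forall => /existsP[b'].
  rewrite -ltnNge => rab; rewrite add0r.
  by apply: normc_Phi_pow; exact: (Phi_far R nu2 n_gt0 M4 NE r0 rab).
apply: lerD; first apply: lerD.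
- apply: le_trans (sum_within _ _ _) _ => //.
    by move=> t j; rewrite /E Phi_torsion.
  rewrite ler_wpM2l// expr2 -sum_ball2 mulr_sumr.
  apply: ler_sum => t /andP[b1 b2].
  have [h1 /andP[h2 h3]] := Phi_near nu2 n_gt0 M4 NE b1 b2 sN Dw w1.
  (* With q the sum of the two quadratic forms, |Phi| <= 1 - q + w^3 <= exp (w^3 - q). *)
  have := @normc_Phi_pow t.1 t.2 (expR (w ^+ 3 - (quadM t.1 + quadM t.2))).
  rewrite -expRM_natl /gauss -!expRD.
  have -> : n%:R * (w ^+ 3 - (quadM t.1 + quadM t.2)) =
    n%:R * w ^+ 3 + (- (n%:R * quadM t.1) - n%:R * quadM t.2) by ring.
  apply; apply: le_trans (expR_ge1Dx _).
  have q1 : 1 - (quadM t.1 + quadM t.2) >= 0.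
    have : w ^+ 2 <= 1; last by lra.
    by rewrite expr_le1// Dw mulr_ge0// mulr_ge0// ltW.
  have -> : PhiM t.1 t.2 = (PhiM t.1 t.2 - ((1 - (quadM t.1 + quadM t.2))%:C)%C) +
     ((1 - (quadM t.1 + quadM t.2))%:C)%C by rewrite subrK.
  apply: le_trans (le_normcD _ _) _; rewrite normc_real ger0_norm//; lra.
- apply: le_trans (sum_within _ _ _) _ => //; first by move=> _; rewrite exprn_ge0.
  rewrite ler_wpM2l// sumr_const -natrX mulr_natl.
  suff -> : #|freq_ball2 (3 * (3 * r))| = (#|bal (9 * r)| ^ 2)%N by [].
  rewrite mulnA -[(3 * 3)%N]/9%N -[RHS]mulnn -cardX; apply: eq_card => -[a b].
  by rewrite !inE.
- rewrite sumr_const -natrX mulr_natl.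
  suff -> : #|zero_sum2| = (#|zsum| ^ 2)%N by [].
  by rewrite -[RHS]mulnn -cardX; apply: eq_card => -[a b]; rewrite !inE.
Qed.

(** The near range is the ball of radius 3 s, although the middle bound holds from s on, so that the
    Gaussian sum is the same one as in the second moment and the two can be compared unevaluated. *)
Lemma first_moment_bound (s r : nat) (w : R) : (0 < r)%N ->
  (nu * (3 * s) < N)%N -> w = 2 * lam * (3 * s)%:R -> w <= 1 ->
  0 <= rho R nu M p r -> 0 <= kappa R nu M p s ->
  (2 - expR (4 * n%:R * w ^+ 3)) * gauss_sum (3 * s)
  - #|bal (9 * r)|%:R * kappa R nu M p s ^+ n - #|zsum|%:R * rho R nu M p r ^+ n
  <= complex.Re (\sum_(th | zsum th) PhiM th 0 ^+ n).
Proof.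
move=> r0 sN Dw w1 rho0 kap0.
set K := kappa _ _ _ _ _ in kap0 *; set Q := rho _ _ _ _ _ in rho0 *.
have l0 := lam_gt0 R nu2 n_gt0 M4 NE.
have ls : lam * s%:R <= 1.
  apply: le_trans w1; rewrite Dw natrM; have : 0 <= lam * s%:R by rewrite mulr_ge0// ltW.
  lra.
rewrite (raddf_sum (@complex.Re R))/= /gauss_sum mulr_sumr -mulr_natl -[X in _ - X * _]mulr1.
have -> : #|bal (9 * r)|%:R * K ^+ n = \sum_(th | bal (9 * r) th) K ^+ n.
  by rewrite sumr_const mulr_natl.
have -> : #|zsum|%:R * 1 * Q ^+ n = \sum_(th | zsum th) Q ^+ n.
  by rewrite mulr1 sumr_const mulr_natl.
rewrite big_mkcond [X in _ - X - _]big_mkcond [X in _ - _ - X]big_mkcond.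
rewrite [leRHS]big_mkcond -!sumrB/=.
apply: ler_sum => th _; rewrite /freq_ball.
have [z|_] := boolP (zsum th); rewrite ?andTb ?andFb; last by rewrite !subr0.
case: ifPn => [b1|].
  have bt : bal (3 * s) th by rewrite /freq_ball z.
  have [h1 h2] := Phi_near nu2 n_gt0 M4 NE bt (freq_ball0 _) sN Dw w1.
  rewrite quad0 addr0 in h1 h2.
  have w01 : 0 <= w <= 1 by rewrite w1 andbT Dw mulr_ge0// mulr_ge0// ltW.
  have := Re_pow_approx n w01 h2 h1.
  set A := if _ then _ else _.
  have A0 : 0 <= A by rewrite /A; case: ifP => // _; rewrite exprn_ge0.
  have := exprn_ge0 n rho0; rewrite /gauss; lra.
rewrite negb_forall => /existsP[a]; rewrite -ltnNge => sa.
have {}sa : (s < cnorm (th a + (0 : freq) a)%R)%N by rewrite ffunE addr0; lia.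
have lo c : normc (PhiM th 0) <= c -> - c ^+ n <= complex.Re (PhiM th 0 ^+ n).
  move/normc_Phi_pow => /(le_trans (Re_le_normc _)).
  by rewrite ler_norml => /andP[].
rewrite sub0r; case: ifPn => [_|].
  apply: le_trans (lo _ (Phi_mid nu2 n_gt0 M4 NE ls sa)).
  by rewrite gerDl oppr_le0 exprn_ge0.
rewrite negb_forall => /existsP[b]; rewrite -ltnNge => rb.
have {}rb : (3 * r < cnorm (th b + (0 : freq) b)%R)%N by rewrite ffunE addr0; lia.
by rewrite oppr0 sub0r; apply: lo; exact: (Phi_far R nu2 n_gt0 M4 NE r0 rb).
Qed.

Lemma card_ball (r : nat) : (#|bal r| <= (2 * r).+1 ^ nu)%N.
Proof.
apply: leq_trans (_ : #|ffun_on (fun c : 'I_p.+1 => cnorm c <= r)%N| <= _)%N.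
  apply/subset_leq_card/fintype.subsetP => th /andP[_ /forallP h].
  by apply/ffun_onP.
by rewrite card_ffun_on card_ord leq_exp2r ?card_cnorm_le//; lia.
Qed.

(** The coordinate 0 is determined by the others. The exponent nu - 1 saved here is that of the
    numerator of the threshold. *)
Lemma card_zero_sum : (#|zsum| <= N ^ nu.-1)%N.
Proof.
case: nu => [|k].
  by apply: leq_trans (max_card _) _; rewrite card_ffun !card_ord.
rewrite /= -[X in (X ^ k)%N](card_ord N) -[X in (_ ^ X)%N]card_ord -card_ffun.
pose f (th : {ffun 'I_k.+1 -> 'I_N}) : {ffun 'I_k -> 'I_N} := [ffun i => th (lift ord0 i)].
rewrite -(@fintype.card_in_image _ _ f); first exact: max_card.
move=> th et; rewrite -!topredE/= /zero_sum => /eqP + /eqP.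
rewrite !big_ord_recl => e1 e2 /ffunP e.
have el i : th (lift ord0 i) = et (lift ord0 i) by have := e i; rewrite !ffunE.
apply/ffunP => i; have [j ->|->] := unliftP ord0 i; first exact: el.
move: e1; under eq_bigr do rewrite el.
by move=> e1; apply: (addIr (\sum_j et (lift ord0 j))); rewrite e1 e2.
Qed.

End FrequencySums.

(** * Moments *)

(** Here v is nu, G the Gaussian sum, A and B the normalised first and second moments, b and z the
    numbers of frequencies in the ball and in total, and k and r the n-th powers of [kappa] and
    [rho]. *)
Lemma moment_arith (R : realType) (v G A B ex ex' b k z r : R) :
  3 <= v -> 1 <= G -> 1 <= b -> 1 <= z -> 0 <= k -> 0 <= r ->
  ex <= 11 / 10 -> ex' <= 11 / 10 ->
  v * (b ^+ 2 * k) <= 1 / 10 -> z ^+ 2 * r <= 1 / 10 ->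
  B <= v * (ex' * G ^+ 2) + v * (b ^+ 2 * k) + z ^+ 2 * r ->
  (2 - ex) * G - b * k - z * r <= A ->
  7 / 10 <= A /\ B <= (1 + v ^+ 2) * A ^+ 2.
Proof.
move=> v3 G1 b1 z1 k0 r0 ex1 ex'1 hk hr hB hA.
have bk : b * k <= 1 / 10.
  have h1 : b * k <= b ^+ 2 * k by rewrite ler_wpM2r// ler_eXnr.
  have h2 : 0 <= b ^+ 2 * k by rewrite mulr_ge0// sqr_ge0.
  have : 1 * (b ^+ 2 * k) <= v * (b ^+ 2 * k) by rewrite ler_wpM2r//; lra.
  lra.
have zr : z * r <= 1 / 10.
  by apply: le_trans hr; rewrite ler_wpM2r// ler_eXnr.
have A7 : 7 / 10 * G <= A.
  have : (9 / 10) * G <= (2 - ex) * G by rewrite ler_wpM2r//; lra.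
  lra.
split; first by lra.
have GG : 1 <= G ^+ 2 by rewrite exprn_ege1.
have h1 : v * (ex' * G ^+ 2) <= v * (11 / 10 * G ^+ 2).
  by rewrite ler_wpM2l ?ler_wpM2r// ?sqr_ge0//; lra.
have h2 : 3 * 1 <= v * G ^+ 2 by apply: ler_pM.
have h3 : (7 / 10 * G) ^+ 2 <= A ^+ 2 by rewrite lerXn2r// ?nnegrE; lra.
have h4 : (1 + v ^+ 2) * (7 / 10 * G) ^+ 2 <= (1 + v ^+ 2) * A ^+ 2.
  by rewrite ler_wpM2l// addr_ge0// sqr_ge0.
apply: le_trans h4; rewrite [(7 / 10 * G) ^+ 2]exprMn.
(* Here 13 / 10 is 11 / 10 from the main term plus 2 / 10 absorbing both errors, and 49 / 100 comes
   from A >= 7 G / 10. At v = 3 the bracket is 4.9 - 3.9. *)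
have h5 : 0 <= ((1 + v ^+ 2) * (49 / 100) - 13 / 10 * v) * G ^+ 2.
  rewrite mulr_ge0 ?sqr_ge0//.
  have : 0 <= v * (v - 3) by rewrite mulr_ge0; lra.
  rewrite expr2; lra.
move: h1 h2 h5; rewrite [(7 / 10) ^+ 2]expr2; move: (G ^+ 2) hB GG => g; lra.
Qed.

(** * From frequency sums back to counts *)

Section MomentRatio.
Variables (R : realType) (nu n M p : nat).
Local Notation N := p.+1.
Local Notation freq := {ffun 'I_nu -> 'I_p.+1}.
Implicit Types (th et : freq).

Hypothesis nu3 : (3 <= nu)%N.
Hypothesis n_gt0 : (0 < n)%N.
Hypothesis M4 : (4 <= M)%N.
Hypothesis NE : N = (nu * (n * M))%N.

Local Notation zsum := (@zero_sum nu p).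
Local Notation A := (complex.Re (\sum_(th | zsum th) Phi R M th 0 ^+ n)).

Let nM : (n * M < N)%N.
Proof. by rewrite NE -[X in (X < _)%N]mul1n ltn_mul2r muln_gt0 n_gt0; lia. Qed.

Let zpos : (0 < #|zsum|)%N.
Proof. by apply/card_gt0P; exists 0; exact: zero_sum0. Qed.

Let M_neq0 : M%:R != 0 :> R[i]. Proof. by rewrite pnatr_eq0; lia. Qed.
Let nu_neq0 : nu%:R != 0 :> R[i]. Proof. by rewrite pnatr_eq0; lia. Qed.

Lemma phase_sum0 (x : nat) : phase_sum R (0 : freq) x = nu%:R.
Proof.
rewrite /phase_sum; under eq_bigr do rewrite ffunE chi0 expr1n.
by rewrite sumr_const card_ord.
Qed.

Lemma first_momentE :
  #|zsum|%:R * (\sum_(x : {ffun 'I_n -> 'I_M}) num_balanced nu (fun j => (x j).+1))%:R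
  = (M * nu)%:R ^+ n * A.
Proof.
have := first_moment R nu nM; rewrite natrM => /(congr1 (@complex.Re R)).
have -> : \sum_(th | zsum th) (\sum_(k < M) phase_sum R th k.+1) ^+ n =
   ((M * nu)%:R ^+ n : R)%:C%C * \sum_(th | zsum th) Phi R M th 0 ^+ n.
  rewrite mulr_sumr; apply: eq_bigr => th _.
  rewrite rmorphXn rmorph_nat -exprMn; congr (_ ^+ n).
  rewrite /Phi; under [in RHS]eq_bigr do rewrite phase_sum0.
  rewrite -mulr_suml !natrM; field.
  by rewrite M_neq0 nu_neq0.
rewrite -!(rmorph_nat (real_complex R)) -rmorphM/=.
by case: (\sum_(th | zsum th) _) => a b /=; rewrite mul0r subr0.
Qed.

Lemma second_moment_le :
  #|zsum|%:R ^+ 2 *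
    (\sum_(x : {ffun 'I_n -> 'I_M}) num_balanced nu (fun j => (x j).+1) ^ 2)%:R
  <= (M * nu ^ 2)%:R ^+ n * \sum_(t : freq * freq | zero_sum2 t) normc (Phi R M t.1 t.2 ^+ n)
  :> R.
Proof.
have := second_moment R nu nM; rewrite natrM natrX => /(congr1 (@normc R)).
rewrite pair_big -!(rmorph_nat (real_complex R)) -rmorphXn -rmorphM normc_real.
rewrite ger0_norm ?mulr_ge0 ?exprn_ge0// => ->.
apply: le_trans (normc_sum _ _ _) _; rewrite mulr_sumr.
apply: ler_sum => -[th et] _ /=.
rewrite -[X in X ^+ n * _]normr_nat -normc_real -!normcX -normcM -exprMn.
rewrite rmorph_nat /Phi mulrC divfK//.
by rewrite natrM natrX mulf_neq0// expf_neq0.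
Qed.

(** The number of zero-sum frequencies cancels in the ratio. The exponential growth is read off the
    smallness of the far terms, which forces that number to be exponentially smaller than nu^n. *)
Lemma moment_ratio (s r : nat) (w : R) : (0 < r)%N ->
  (nu * (3 * s) < N)%N ->
  w = 2 * (M%:R * unit_angle R p) * (3 * s)%:R -> w <= 1 ->
  0 <= kappa R nu M p s -> 1 - 2 / (nu ^ 2)%:R <= rho R nu M p r ->
  expR (4 * n%:R * w ^+ 3) <= 11 / 10 ->
  nu%:R * (#|@freq_ball nu p (9 * r)|%:R ^+ 2 * kappa R nu M p s ^+ n) <= 1 / 10 ->
  #|zsum|%:R ^+ 2 * rho R nu M p r ^+ n <= 1 / 10 ->
  let S1 := (\sum_(x : {ffun 'I_n -> 'I_M}) num_balanced nu (fun j => (x j).+1))%N in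
  let S2 := (\sum_(x : {ffun 'I_n -> 'I_M}) num_balanced nu (fun j => (x j).+1) ^ 2)%N in
  2 ^+ n * (M ^ n)%:R <= S1%:R :> R /\
  S2%:R * (M ^ n)%:R <= (1 + nu%:R ^+ 2) * S1%:R ^+ 2 :> R.
Proof.
move=> r0 sN Dw w1 kap0 rho_ge c1 c2 c3.
have nu3R : 3 <= nu%:R :> R by rewrite ler_nat.
have nu9 : 9 <= nu%:R ^+ 2 :> R by nra.
have rho0 : 0 <= rho R nu M p r.
  apply: le_trans rho_ge; rewrite subr_ge0 natrX ler_pdivrMr; lra.
have nu2 : (2 <= nu)%N by exact: ltnW.
have B1 := second_moment_bound nu2 n_gt0 M4 NE r0 sN Dw w1 rho0 kap0.
have A1 := first_moment_bound nu2 n_gt0 M4 NE r0 sN Dw w1 rho0 kap0.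
have E1 := first_momentE; have E2 := second_moment_le.
set S1 := (\sum_x _)%N in E1; set S2 := (\sum_x _)%N in E2 => /=.
rewrite -/S1 -/S2.
have G1 := @gauss_sum_ge1 R nu n M p (3 * s).
set Gm := gauss_sum _ _ _ _ _ _ in A1 B1 G1.
set kn := _ ^+ n in c2 A1 B1; set rn := rho _ _ _ _ _ ^+ n in c3 A1 B1.
set b := #|_|%:R in c2 A1 B1; set z := #|_|%:R in c3 A1 B1 E1 E2.
set AA := A in A1 E1; set BB := \sum_(t | _) _ in B1 E2.
set ex := expR _ in c1 A1; set ex' := expR _ in B1.
have kn0 : 0 <= kn by exact: exprn_ge0.
have rn0 : 0 <= rn by exact: exprn_ge0.
have b1 : 1 <= b.
  by rewrite ler1n; apply/card_gt0P; exists 0; exact: freq_ball0.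
have z1 : 1 <= z by rewrite ler1n zpos.
have ex'1 : ex' <= 11 / 10.
  apply: le_trans c1; rewrite ler_expR -mulrA ler_peMl//; last by lra.
  have u0 := ltW (unit_angle_gt0 R p).
  rewrite mulr_ge0// exprn_ge0// Dw; apply: mulr_ge0 => //.
  by apply: mulr_ge0 => //; exact: mulr_ge0.
have [AA7 BA] := moment_arith nu3R G1 b1 z1 kn0 rn0 c1 ex'1 c2 c3 B1 A1.
have z0 : 0 < z by lra.
have S1E : S1%:R = (M * nu)%:R ^+ n * AA / z by rewrite -E1; field; rewrite gt_eqF.
have Mn0 : 0 < (M ^ n)%:R :> R by rewrite ltr0n expn_gt0 (leq_trans _ M4).
split.
  (* As nu^2 rho >= nu^2 - 2 >= 7, the far bound gives z^2 4^n <= nu^(2 n) / 10, and A^2 exceeds 1 /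
     10. *)
  have rn4 : 4 ^+ n <= nu%:R ^+ (2 * n) * rn.
    rewrite exprM -exprMn lerXn2r// ?nnegrE ?mulr_ge0 ?sqr_ge0//.
    have : nu%:R ^+ 2 * (1 - 2 / nu%:R ^+ 2) <= nu%:R ^+ 2 * rho R nu M p r.
      by rewrite ler_wpM2l ?sqr_ge0// -natrX.
    rewrite mulrBr mulr1 mulrCA divff; last by rewrite gt_eqF//; lra.
    lra.
  rewrite -(@ler_pXn2r _ 2)// ?nnegrE ?mulr_ge0 ?exprn_ge0//.
  rewrite S1E.
  have -> : ((M * nu)%:R ^+ n * AA / z) ^+ 2 =
      (nu%:R ^+ (2 * n) * AA ^+ 2 / z ^+ 2) * (M ^ n)%:R ^+ 2.
    rewrite [(2 * n)%N]mulnC exprM natrX.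
    have -> : (M * nu)%:R ^+ n = M%:R ^+ n * nu%:R ^+ n :> R by rewrite natrM exprMn.
    move: (M%:R ^+ n) (nu%:R ^+ n) => m v.
    by field; rewrite gt_eqF.
  rewrite exprMn ler_wpM2r ?sqr_ge0// ler_pdivlMr ?exprn_gt0//.
  have -> : (2 ^+ n) ^+ 2 = 4 ^+ n :> R.
    by rewrite exprAC; congr (_ ^+ n); ring.
  have nn : 0 <= nu%:R ^+ (2 * n) :> R by rewrite exprn_ge0.
  have g1 : nu%:R ^+ (2 * n) * (1 / 10) <= nu%:R ^+ (2 * n) * AA ^+ 2.
    by rewrite ler_wpM2l// expr2; nra.
  apply: le_trans g1; apply: (@le_trans _ _ (nu%:R ^+ (2 * n) * rn * z ^+ 2)).
    by rewrite ler_wpM2r ?sqr_ge0.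
  by rewrite -mulrA ler_wpM2l// mulrC.
have z20 : 0 < z ^+ 2 by rewrite exprn_gt0.
rewrite -(ler_pM2l z20) mulrA.
have -> : z ^+ 2 * ((1 + nu%:R ^+ 2) * S1%:R ^+ 2) =
  ((1 + nu%:R ^+ 2) * AA ^+ 2) * ((M * nu ^ 2)%:R ^+ n * (M ^ n)%:R).
  have -> : (M * nu ^ 2)%:R ^+ n * (M ^ n)%:R = ((M * nu)%:R ^+ n) ^+ 2 :> R.
    by rewrite (natrX _ M) -exprMn exprAC; congr (_ ^+ n); rewrite !natrM; ring.
  by rewrite S1E; field; rewrite gt_eqF.
apply: (@le_trans _ _ ((M * nu ^ 2)%:R ^+ n * BB * (M ^ n)%:R)).
  by rewrite ler_pM2r.
by rewrite mulrAC mulrC ler_wpM2r.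
Qed.

End MomentRatio.

(** * Asymptotics *)

Section Asymptotics.
Variable R : realType.
Implicit Types (C c y e : R).

(** By exp (c y) >= (c y)^(m+1) / (m+1)!; from y = [D] on, this is at least 10 C y^m. *)
Lemma poly_exp_small C c (m : nat) : 0 <= C -> 0 < c ->
  exists Y : R, forall y, Y <= y -> C * y ^+ m * expR (- (c * y)) <= 1 / 10.
Proof.
move=> C0 c0; pose F : R := (m.+1)`!%:R; pose D := 10 * C * F / c ^+ m.+1.
have F0 : 0 < F by rewrite ltr0n fact_gt0.
exists (Num.max 1 D) => y; rewrite ge_max => /andP[y1 yD].
have y0 : 0 < y by lra.
have cy : 0 <= c * y by rewrite mulr_ge0// ltW.
have h := expR_ge1Dxn m cy.
rewrite expRN ler_pdivrMr ?expR_gt0//.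
have h2 : (c * y) ^+ m.+1 / F <= expR (c * y) by rewrite -/F in h; lra.
apply: le_trans (_ : 1 / 10 * ((c * y) ^+ m.+1 / F) <= _); last by rewrite ler_wpM2l.
rewrite exprMn exprS (exprS y) -exprS.
have c1 : 0 < c ^+ m.+1 by rewrite exprn_gt0.
have : D * (c ^+ m.+1 * y ^+ m) <= y * (c ^+ m.+1 * y ^+ m).
  by rewrite ler_wpM2r// mulr_ge0 ?exprn_ge0 ?ltW.
have -> : D * (c ^+ m.+1 * y ^+ m) = 10 * C * F * y ^+ m.
  by rewrite /D; move: (c ^+ m.+1) c1 => a a0; field; rewrite gt_eqF.
move=> h3; rewrite mulrA ler_pdivlMr//.
lra.
Qed.

(** In terms of y = n^(1/5) all scales become integral powers: s is near y^3 and [lam * s] is of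
    order y^(-2). *)
Lemma fifth_root (n : nat) : (0 < n)%N ->
  let y : R := expR (ln n%:R / 5) in 0 < y /\ y ^+ 5 = n%:R.
Proof.
move=> n0; split; first exact: expR_gt0.
by rewrite -expRM_natl mulrC divfK// lnK// posrE ltr0n.
Qed.

Lemma fifth_root_large (Y : R) : exists n0 : nat, forall n : nat, (n0 <= n)%N ->
  (0 < n)%N /\ Y <= expR (ln n%:R / 5).
Proof.
pose Z := Num.max 1 Y; pose n0 := (Num.truncn (Z ^+ 5)).+1; exists n0 => n h.
have n1 : (0 < n)%N by apply: leq_trans h.
split => //; have [y0 y5] := fifth_root n1; set y := expR _ in y0 y5 *.
apply: (@le_trans _ _ Z); first by rewrite le_max lexx orbT.
have Z1 : 1 <= Z by rewrite le_max lexx.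
rewrite -(@ler_pXn2r _ 5)// ?nnegrE ?(ltW y0)//; last by lra.
rewrite y5; apply: le_trans (_ : n0%:R <= _); last by rewrite ler_nat.
by apply/ltW; rewrite truncnS_gt.
Qed.

Lemma nat_cube_approx y : 2 <= y ->
  exists s : nat, s%:R <= y ^+ 3 /\ y ^+ 3 / 2 <= s%:R.
Proof.
move=> y2; exists (Num.truncn (y ^+ 3)).
have y8 : 8 <= y ^+ 3.
  have -> : 8 = 2 ^+ 3 :> R by ring.
  by rewrite lerXn2r// nnegrE; lra.
have y0 : 0 <= y ^+ 3 by lra.
have := truncn_le (y ^+ 3); rewrite y0 => h1; split => //.
have := truncnS_gt (y ^+ 3); rewrite -natr1 => h2; lra.
Qed.

Lemma powB1_le_exp (x : R) (n : nat) : 0 <= 1 - x -> (1 - x) ^+ n <= expR (- (n%:R * x)).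
Proof.
move=> x1; rewrite -mulrN expRM_natl lerXn2r// ?nnegrE ?expR_ge0//.
exact: expR_ge1Dx.
Qed.

Section Eventually.
Variable nu : nat.
Hypothesis nu3 : (3 <= nu)%N.

Let nu3R : 3 <= nu%:R :> R. Proof. by rewrite ler_nat. Qed.
Let nu9 : 9 <= nu%:R ^+ 2 :> R.
Proof. by move: nu3R; set v := nu%:R => v3; nra. Qed.

Let rho0 : R := 1 - 2 / nu%:R ^+ 2.

Let rho0_bounds : 7 / 9 <= rho0 < 1.
Proof.
have h := nu9.
have -> : rho0 = 1 - 2 * (nu%:R ^+ 2)^-1 by [].
have : (nu%:R ^+ 2)^-1 <= 9^-1 :> R by rewrite lef_pV2 ?posrE; lra.
have : 0 < (nu%:R ^+ 2)^-1 :> R by rewrite invr_gt0; lra.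
by move=> h1 h2; apply/andP; split; lra.
Qed.

(* At the threshold M ^ (2 (nu - 1)) balances (1 - 2 / nu ^ 2) ^ n; e is the room
   left for the decay of the characteristic function far from the origin. *)
Lemma far_terms_small (c1 : R) : 2 * (nu%:R - 1) / ln (rho0^-1) < c1 ->
  exists e0 : R, 0 < e0 /\ exists n0 : nat, forall n M : nat, (n0 <= n)%N ->
  (1 < M)%N -> c1 * ln M%:R <= n%:R -> forall e rho, 0 <= e <= e0 ->
  0 <= rho -> rho = 1 - 2 * (1 - e) / nu%:R ^+ 2 ->
  (nu * (n * M))%:R ^+ (2 * nu.-1) * rho ^+ n <= 1 / 10.
Proof.
have /andP[r1 r2] := rho0_bounds; have v3 := nu3R.
have r0 : 0 < rho0 by lra.
have v1 : nu.-1%:R = nu%:R - 1 :> R by rewrite -subn1 natrB//; lia.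
set L := ln rho0^-1.
have L0 : 0 < L by rewrite ln_gt0// invf_gt1.
have expL : expR (- L) = rho0 by rewrite /L lnV ?posrE// opprK lnK ?posrE.
move=> hc; have c10 : 0 < c1.
  by apply: le_lt_trans hc; rewrite divr_ge0 ?(ltW L0)// mulr_ge0; lra.
(* The strict margin at the threshold. One half of it pays for e, the other half beats the
   polynomial factor in n. *)
pose g := L - 2 * (nu%:R - 1) / c1.
have g0 : 0 < g.
  by rewrite /g subr_gt0 ltr_pdivrMr// -ltr_pdivrMl// mulrC.
exists g; split => //.
have g20 : 0 < g / 2 by lra.
have [Y hY] := @poly_exp_small (nu%:R ^+ (2 * nu.-1)) (g / 2) (2 * nu.-1)
   (exprn_ge0 _ (ler0n _ _)) g20.
exists (Num.truncn Y).+1 => n M hn M1 hM e rho /andP[e0 eg] rhop Drho.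
have nY : Y <= n%:R.
  apply: le_trans (_ : (Num.truncn Y).+1%:R <= _); last by rewrite ler_nat.
  by apply/ltW; rewrite truncnS_gt.
apply: le_trans (hY _ nY).
have M0 : 0 < M%:R :> R by rewrite ltr0n ltnW.
have lnM : ln M%:R <= n%:R / c1 :> R by rewrite ler_pdivlMr// mulrC.
have Mle : M%:R ^+ (2 * nu.-1) <= expR (n%:R * (2 * (nu%:R - 1) / c1)) :> R.
  rewrite -[in leLHS](lnK (_ : M%:R \is Num.pos)) ?posrE// -expRM_natl ler_expR.
  rewrite natrM v1; have : 0 <= 2 * (nu%:R - 1) :> R by lra.
  move=> h; apply: le_trans (ler_wpM2l h lnM) _.
  by rewrite le_eqVlt; apply/orP; left; apply/eqP; ring.
have rhole : rho ^+ n <= expR (n%:R * (- L + g / 2)).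
  rewrite expRM_natl lerXn2r// ?nnegrE ?expR_ge0// expRD expL.
  (* Since nu^2 >= 9, 2 / nu^2 <= 2 / 9, which is below rho0 / 2 >= 7 / 18. *)
  have h1 : rho <= rho0 * (1 + e / 2).
    have v9 := nu9.
    have -> : rho = rho0 + e * (2 / nu%:R ^+ 2) by rewrite Drho /rho0; ring.
    have -> : rho0 * (1 + e / 2) = rho0 + e * (rho0 / 2) by field.
    rewrite lerD2l ler_wpM2l//.
    have : (nu%:R ^+ 2)^-1 <= 9^-1 :> R by rewrite lef_pV2 ?posrE; lra.
    lra.
  apply: le_trans h1 _; rewrite ler_wpM2l ?(ltW r0)//.
  by apply: le_trans (expR_ge1Dx _) _; rewrite ler_expR; lra.
rewrite !natrM !exprMn -!mulrA ler_wpM2l ?exprn_ge0// ler_wpM2l ?exprn_ge0//.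
apply: le_trans (ler_pM _ _ Mle rhole) _; rewrite ?exprn_ge0//.
by rewrite -expRD ler_expR /g; rewrite le_eqVlt; apply/orP; left; apply/eqP; field; rewrite gt_eqF.
Qed.

End Eventually.
End Asymptotics.

(** With lam of order 1 / n and s near n^(3/5), the cubic error n (lam s)^3 is of order n^(-1/5)
    while the quadratic decay n (lam s)^2 is of order n^(1/5). This is what makes s a valid cut
    between the near and middle ranges. *)
Lemma near_scale (R : realType) (n v lam y s : R) :
  3 <= v -> 0 < n -> y ^+ 5 = n -> 400 * 500 <= y -> s <= y ^+ 3 ->
  y ^+ 3 / 2 <= s -> 4 / (v * n) <= lam -> lam * n <= 8 / 3 ->
  [/\ s <= n, 0 <= lam * s <= 6 * lam * s, 6 * lam * s <= 1,
      4 * n * (6 * lam * s) ^+ 3 <= 1 / 11 &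
      4 * y <= v ^+ 2 * n * (lam * s) ^+ 2].
Proof.
move=> v3 n0 y5 yB sy ys l1 l2.
have y0 : 0 < y by lra.
have y30 : 0 < y ^+ 3 by rewrite exprn_gt0.
have y20 : 0 < y ^+ 2 by rewrite exprn_gt0.
have v0 : 0 < v by lra.
have vn0 : 0 < v * n by rewrite mulr_gt0.
have l0 : 0 < lam by apply: lt_le_trans l1; rewrite divr_gt0.
have s0 : 0 <= s by lra.
have ls0 : 0 <= lam * s by rewrite mulr_ge0// ltW.
have sn2 : s * y ^+ 2 <= n by rewrite -y5 (exprD y 3 2) ler_wpM2r// ltW.
have yy : 400 * 500 * y <= y ^+ 2.
  by have := mulr_ge0 (ltW y0) (_ : 0 <= y - 400 * 500); rewrite expr2; lra.
have y21 : 16 <= y ^+ 2 by lra.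
have wy : 6 * lam * s * y ^+ 2 <= 16.
  have : lam * (s * y ^+ 2) <= lam * n by rewrite ler_wpM2l// ltW.
  lra.
have u0 : 0 <= 6 * lam * s by lra.
split=> //.
- by apply: le_trans sn2; rewrite ler_peMr//; lra.
- by rewrite ls0; lra.
- have : (lam * s) * 16 <= (lam * s) * y ^+ 2 by rewrite ler_wpM2l.
  lra.
(* The bound 400 * 500 on y is chosen to exceed 4 * 16^3 * 11 = 180224. *)
- have h1 : n * (6 * lam * s) ^+ 3 * y <= 16 ^+ 3.
    have -> : n * (6 * lam * s) ^+ 3 * y = (6 * lam * s * y ^+ 2) ^+ 3 by rewrite -y5; ring.
    by have u1 := mulr_ge0 u0 (ltW y20); rewrite lerXn2r ?nnegrE.
  have h2 : 0 <= n * (6 * lam * s) ^+ 3 by exact: mulr_ge0 (ltW n0) (exprn_ge0 3 u0).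
  have h4 : 16 ^+ 3 = 4096 :> R by ring.
  rewrite -mulrA; move: h1 h2; rewrite h4; move: (n * _ ^+ 3) => z h1 h2.
  have yB0 : 0 <= y - 400 * 500 by rewrite subr_ge0.
  have := mulr_ge0 h2 yB0; clear -h1; lra.
- have h1 : 2 * y ^+ 3 <= v * n * (lam * s).
    have : 4 * s <= v * n * (lam * s) by rewrite mulrA ler_wpM2r// mulrC -ler_pdivrMr.
    lra.
  have h2 : (2 * y ^+ 3) ^+ 2 <= (v * n * (lam * s)) ^+ 2.
    rewrite lerXn2r// ?nnegrE; first by lra.
    by rewrite mulr_ge0// ltW.
  rewrite -(ler_pM2r n0); have -> : 4 * y * n = (2 * y ^+ 3) ^+ 2 by rewrite -y5; ring.
  by apply: le_trans h2 _; rewrite le_eqVlt; apply/orP; left; apply/eqP; ring.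
Qed.

Lemma kappa_arith (R : realType) (v x : R) : 3 <= v -> 0 <= x -> x <= 1 ->
  0 <= 1 - x ^+ 2 / (200 * 100) / v ^+ 2.
Proof.
move=> v3 x0 x1; have v2 : 9 <= v ^+ 2 by nra.
rewrite subr_ge0 ler_pdivrMr; last by lra.
have x2 : x ^+ 2 <= 1 by rewrite expr_le1.
lra.
Qed.

Lemma expR_small (R : realType) (z : R) : z <= 1 / 11 -> expR z <= 11 / 10.
Proof.
move=> z1; have := expR_ge1Dx (- z); rewrite expRN -div1r ler_pdivlMr ?expR_gt0//.
by have := expR_gt0 z; move: (expR z) => E E0 h; nra.
Qed.

Lemma near_terms_small (R : realType) (nu K : nat) : (3 <= nu)%N ->
  exists n0 : nat, forall n M p : nat, (n0 <= n)%N -> (4 <= M)%N ->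
  p.+1 = (nu * (n * M))%N ->
  let lam : R := M%:R * unit_angle R p in
  (0 < n)%N /\ exists s : nat,
  [/\ (nu * (3 * s) < p.+1)%N, 2 * lam * (3 * s)%:R <= 1,
      0 <= kappa R nu M p s,
      expR (4 * n%:R * (2 * lam * (3 * s)%:R) ^+ 3) <= 11 / 10 &
      nu%:R * (#|@freq_ball nu p (9 * (K * n))|%:R ^+ 2 * kappa R nu M p s ^+ n)
        <= 1 / 10].
Proof.
move=> nu3; have nu3R : 3 <= nu%:R :> R by rewrite ler_nat.
have v0 : 0 < nu%:R :> R by lra.
(* From n (lam s)^2 >= 4 y / nu^2, the exponent n (lam s)^2 / (200 * 100 * nu^2) is at least c y. *)
pose c : R := ((50 * 100) * nu%:R ^+ 4)^-1.
have k5 : 0 < (50 * 100) :> R by lra.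
have v40 : 0 < nu%:R ^+ 4 :> R by rewrite exprn_gt0.
have c0 : 0 < c by rewrite invr_gt0; apply: mulr_gt0 k5 v40.
(* The ball of radius 9 K n has at most ((18 K + 1) n)^nu points; squared, with n = y^5, this gives
   degree 10 nu in y. *)
pose C : R := nu%:R * (18 * K + 1)%:R ^+ (2 * nu).
have C0 : 0 <= C by rewrite mulr_ge0// exprn_ge0.
have [Y hY] := poly_exp_small (10 * nu) C0 c0.
have [n0 hn0] := fifth_root_large (Num.max Y (400 * 500)).
exists n0 => n M p /hn0[n_gt0 yY] M4 NE lam; split=> //.
have [y0 y5] := fifth_root R n_gt0.
move: yY y0 y5; set y := expR _; rewrite ge_max => /andP[yY y2] y0 y5.
have [s [sy ys]] := @nat_cube_approx R y ltac:(lra).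
exists s.
have n0R : 0 < n%:R :> R by rewrite ltr0n.
have lE : lam = 2 * pi / (nu%:R * n%:R).
  by rewrite /lam -natrM; apply: lamE NE => //; exact: ltnW.
have vn0 : 0 < nu%:R * n%:R :> R by rewrite mulr_gt0.
have pi4 : pi <= 4 :> R by have := pihalf_lt2 R; lra.
have pi2 := pi_ge2 R.
have l1 : 4 / (nu%:R * n%:R) <= lam by rewrite lE ler_pM2r ?invr_gt0//; lra.
have l2 : lam * n%:R <= 8 / 3.
  rewrite lE invfM mulrA divfK ?gt_eqF// ler_pdivrMr//; lra.
have l0 : 0 < lam by apply: lt_le_trans l1; rewrite divr_gt0.
have [sn /andP[ls0 lw] w1 wn yl] := near_scale nu3R n0R y5 y2 sy ys l1 l2.
have wE : 2 * lam * (3 * s)%:R = 6 * lam * s%:R by rewrite natrM; ring.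
rewrite wE; clear wE.
have kge : 0 <= kappa R nu M p s.
  rewrite /kappa natrX; apply: kappa_arith nu3R ls0 (le_trans lw w1).
split=> //.
- rewrite ler_nat in sn; rewrite NE ltn_mul2l (leq_trans _ nu3)//=.
  apply: leq_ltn_trans (leq_mul (leqnn 3) sn) _.
  by rewrite mulnC ltn_pmul2l.
- exact: expR_small.
- apply: le_trans (hY y yY).
  have kp : kappa R nu M p s ^+ n <= expR (- (c * y)).
    apply: le_trans (powB1_le_exp n kge) _; rewrite ler_expR lerN2.
    have -> : c * y = 4 * y / ((200 * 100) * nu%:R ^+ 4).
      by rewrite /c; field; rewrite gt_eqF.
    rewrite ler_pdivrMr; last by apply: mulr_gt0 v40; rewrite mulr_gt0 ?ltr0n.
    have -> : n%:R * ((lam * s%:R) ^+ 2 / (200 * 100) / (nu ^ 2)%:R) *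
      ((200 * 100) * nu%:R ^+ 4) =
      nu%:R ^+ 2 * n%:R * (lam * s%:R) ^+ 2; last by [].
    by rewrite natrX; field; rewrite gt_eqF.
  have Bn : #|@freq_ball nu p (9 * (K * n))|%:R <= ((18 * K + 1)%:R * y ^+ 5) ^+ nu :> R.
    rewrite y5 -natrM -natrX ler_nat.
    apply: leq_trans (card_ball (ltnW nu3) n_gt0 M4 NE _) _.
    rewrite leq_exp2r ?(leq_trans _ nu3)// mulnDl mul1n -addn1 !mulnA.
    by rewrite leq_add2l.
  rewrite /C -2!(mulrA nu%:R) ler_wpM2l//.
  have -> : (18 * K + 1)%:R ^+ (2 * nu) * y ^+ (10 * nu) * expR (- (c * y)) =
     (((18 * K + 1)%:R * y ^+ 5) ^+ nu) ^+ 2 * expR (- (c * y)).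
    congr (_ * _).
    by rewrite -exprM [(nu * 2)%N]mulnC exprMn -exprM mulnA.
  apply: ler_pM => //; rewrite ?exprn_ge0//.
  have X0 : 0 <= (18 * K + 1)%:R * y ^+ 5 by rewrite mulr_ge0// exprn_ge0// ltW.
  by rewrite lerXn2r ?nnegrE ?exprn_ge0.
Qed.

Lemma moments_eventually (R : realType) (nu : nat) (c1 : R) : (3 <= nu)%N ->
  2 * (nu%:R - 1) / ln ((1 - 2 * nu%:R ^- 2)^-1) < c1 ->
  exists n0 : nat, forall n M : nat, (n0 <= n)%N -> (4 <= M)%N ->
  c1 * ln M%:R <= n%:R ->
  let S1 := (\sum_(x : {ffun 'I_n -> 'I_M}) num_balanced nu (fun j => (x j).+1))%N in
  let S2 := (\sum_(x : {ffun 'I_n -> 'I_M}) num_balanced nu (fun j => (x j).+1) ^ 2)%N in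
  [/\ (0 < n)%N, 2 ^+ n * (M ^ n)%:R <= S1%:R :> R &
      S2%:R * (M ^ n)%:R <= (1 + nu%:R ^+ 2) * S1%:R ^+ 2 :> R].
Proof.
move=> nu3 hc; have nu3R : 3 <= nu%:R :> R by rewrite ler_nat.
have v0 : 0 < nu%:R :> R by lra.
have [e0 [e0gt [n1 far]]] := far_terms_small nu3 hc.
(* For r = K n the defect 6 / (lam r) equals 3 nu / (pi K), and pi >= 2 makes it at most e0. *)
pose K := (Num.truncn (3 * nu%:R / (2 * e0))).+1.
have K0 : (0 < K)%N by [].
have K0R : 0 < K%:R :> R by rewrite ltr0n.
have Ke : 3 * nu%:R / (2 * K%:R) <= e0.
  have := truncnS_gt (3 * nu%:R / (2 * e0)); rewrite -/K.
  rewrite ltr_pdivrMr ?mulr_gt0// ler_pdivrMr ?mulr_gt0// => h; lra.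
have [n2 near] := near_terms_small R K nu3.
exists (maxn n1 n2).+1 => n M hn M4 hM S1 S2.
have [hn1 hn2] : (n1 <= n)%N /\ (n2 <= n)%N.
  by split; apply: leq_trans (ltnW hn); rewrite ?leq_maxl ?leq_maxr.
pose p := (nu * (n * M)).-1.
have n0 : (0 < n)%N by apply: leq_trans hn.
have NE : p.+1 = (nu * (n * M))%N.
  by rewrite prednK// !muln_gt0 n0 (leq_trans _ M4)// (leq_trans _ nu3).
have [_ [s [sN w1 kap ex bk]]] := near n M p hn2 M4 NE.
pose e : R := 6 / (M%:R * unit_angle R p * (K * n)%:R).
have n0R : 0 < n%:R :> R by rewrite ltr0n.
have u0 := unit_angle_gt0 R p.
have M0 : 0 < M%:R :> R by rewrite ltr0n (leq_trans _ M4).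
have ee : 0 <= e <= e0.
  apply/andP; split.
    by rewrite divr_ge0// mulr_ge0// mulr_ge0// ltW.
  apply: le_trans Ke; rewrite /e (@lamE R nu n M p (ltnW nu3) n0 M4 NE).
  have pi2 := pi_ge2 R; have p0 := pi_gt0 R.
  have -> : 6 / (2 * pi / (nu * n)%:R * (K * n)%:R) = 3 * nu%:R / (pi * K%:R) :> R.
    rewrite !natrM; clear pi2; move: (pi : R) p0 => q p0; field.
    by rewrite !gt_eqF.
  rewrite ler_wpM2l ?mulr_ge0 ?(ltW v0)//.
  by rewrite lef_pV2 ?posrE ?mulr_gt0// ler_wpM2r// ltW.
have rhoE : rho R nu M p (K * n) = 1 - 2 * (1 - e) / nu%:R ^+ 2 by rewrite /rho natrX.
have rho_ge : 1 - 2 / (nu ^ 2)%:R <= rho R nu M p (K * n).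
  rewrite rhoE natrX lerD2l lerN2 ler_wpM2r ?invr_ge0 ?exprn_ge0//.
  by case/andP: ee => ee _; lra.
have rho0 : 0 <= rho R nu M p (K * n).
  apply: le_trans rho_ge; rewrite natrX subr_ge0 ler_pdivrMr ?exprn_gt0//.
  by move: (nu%:R) nu3R => v v3; nra.
have Kn0 : (0 < K * n)%N by rewrite muln_gt0 K0.
have zr : #|@zero_sum nu p|%:R ^+ 2 * rho R nu M p (K * n) ^+ n <= 1 / 10.
  apply: le_trans (far n M hn1 _ hM e _ ee rho0 rhoE); last exact: leq_trans M4.
  rewrite ler_wpM2r ?exprn_ge0// -NE [(2 * _)%N]mulnC exprM lerXn2r ?nnegrE ?exprn_ge0//.
  by rewrite -natrX ler_nat card_zero_sum.
by have [h1 h2] := moment_ratio nu3 n0 M4 NE Kn0 sN erefl w1 kap rho_ge ex bk zr.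
Qed.

(** * Uniform random vectors and the main theorem *)

(** Cantelli's inequality for the uniform law on T, with V bounding the variance relative to the
    squared mean: Chebyshev's argument for E - z shifted by u. *)
Lemma cantelli_count (R : realType) (T : finType) (z : T -> R) (V d : R) :
  0 < \sum_x z x -> 0 <= V -> d < 1 ->
  (\sum_x z x ^+ 2) * #|T|%:R <= (1 + V) * (\sum_x z x) ^+ 2 ->
  (1 - d) ^+ 2 / ((1 - d) ^+ 2 + V) * #|T|%:R <=
  #|[pred x | d * ((\sum_x z x) / #|T|%:R) <= z x]|%:R.
Proof.
set S := \sum_x z x => S0 V0 d1 h2; set m : R := #|T|%:R in h2 *.
have m0 : 0 < m.
  rewrite ltr0n lt0n; apply: contraTneq S0 => /card0_eq T0.
  by rewrite /S big1 ?ltxx// => x; have := T0 x; rewrite inE.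
set E := S / m; have E0 : 0 < E by rewrite divr_gt0.
have SE : S = E * m by rewrite divfK// gt_eqF.
set t := 1 - d; have t0 : 0 < t by rewrite subr_gt0.
(* The shift that minimises (V E^2 + u^2) / (t E + u)^2. *)
pose u := E * V / t; have u0 : 0 <= u by exact: divr_ge0 (mulr_ge0 (ltW E0) V0) (ltW t0).
pose a := E * t + u.
have a0 : 0 < a by rewrite ltr_wpDr// mulr_gt0.
set good := [pred x | d * E <= z x]; set g : R := #|good|%:R.
have gE : g = \sum_(x | good x) 1 by rewrite sumr_const.
have bad : (m - g) * a ^+ 2 <= \sum_x (E - z x + u) ^+ 2.
  have -> : m - g = \sum_(x | ~~ good x) 1.
    have -> : m = \sum_(x : T) 1 by rewrite sumr_const.
    by rewrite gE (bigID good)/= addrC addrK.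
  rewrite mulr_suml [leRHS](bigID good)/= ler_wpDl//.
    by apply: sumr_ge0 => x _; exact: sqr_ge0.
  apply: ler_sum => x; rewrite -ltNge mul1r => xb.
  have h : a <= E - z x + u by rewrite /a /t; lra.
  by rewrite lerXn2r ?nnegrE ?(ltW a0)// (le_trans (ltW a0) h).
have sumE : \sum_x (E - z x + u) ^+ 2 =
    m * (E + u) ^+ 2 - 2 * (E + u) * S + \sum_x z x ^+ 2.
  transitivity (\sum_x ((E + u) ^+ 2 - (2 * (E + u)) * z x + z x ^+ 2)).
    by apply: eq_bigr => x _; ring.
  by rewrite big_split/= sumrB sumr_const -mulr_sumr -/S -[X in X - _ + _ = _]mulr_natl.
have sq : \sum_x z x ^+ 2 <= (1 + V) * E ^+ 2 * m.
  rewrite -(ler_pM2r m0); apply: le_trans h2 _; rewrite SE.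
  by rewrite le_eqVlt; apply/orP; left; apply/eqP; ring.
have tV : 0 < t ^+ 2 + V by rewrite ltr_pwDl// exprn_gt0.
have le1 : (m - g) * a ^+ 2 <= m * (u ^+ 2 + V * E ^+ 2).
  apply: le_trans bad _; rewrite sumE SE; move: sq; set q := \sum_x z x ^+ 2 => sq.
  have -> : m * (u ^+ 2 + V * E ^+ 2) =
    m * (E + u) ^+ 2 - 2 * (E + u) * (E * m) + (1 + V) * E ^+ 2 * m by ring.
  by rewrite lerD2l.
have aE : a = E * (t ^+ 2 + V) / t by rewrite /a /u; field; rewrite gt_eqF.
have le2 : (m - g) * (t ^+ 2 + V) <= m * V.
  have k0 : 0 < E ^+ 2 * (t ^+ 2 + V) / t ^+ 2.
    by exact: divr_gt0 (mulr_gt0 (exprn_gt0 2 E0) tV) (exprn_gt0 2 t0).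
  rewrite -(ler_pM2r k0).
  have -> : (m - g) * (t ^+ 2 + V) * (E ^+ 2 * (t ^+ 2 + V) / t ^+ 2) = (m - g) * a ^+ 2.
    by rewrite aE; field; rewrite gt_eqF.
  have -> : m * V * (E ^+ 2 * (t ^+ 2 + V) / t ^+ 2) = m * (u ^+ 2 + V * E ^+ 2).
    by rewrite /u; field; rewrite gt_eqF.
  exact: le1.
rewrite mulrAC ler_pdivrMr//; lra.
Qed.

(** * Reduction of the random vector to counting in a finite grid *)

Section UniformVectors.
Context (R : realType) (d : measure_display) (T : measurableType d)
  (P : probability T R).
Variables (n M : nat) (X : 'I_n -> {RV P >-> nat}).
Hypothesis X_indep : mutually_independent X.
Hypothesis X_unif : forall i, uniform_on_1_to M (X i).
Hypothesis M_gt0 : (0 < M)%N.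
Local Notation points := {ffun 'I_n -> 'I_M}.

(** The vector takes values in a countable set, so for arbitrary Q the event is a countable union of
    measurable fibres. *)
Lemma measurable_vector_event (Q : ('I_n -> nat) -> Prop) :
  measurable [set w | Q (fun i => X i w)].
Proof.
have -> : [set w | Q (fun i => X i w)] =
  \bigcup_(x : {ffun 'I_n -> nat})
    (if pselect (Q x) then \bigcap_i (X i @^-1` [set x i]) else set0).
  apply/seteqP; split => w /=.
    move=> Qw; exists [ffun i => X i w] => //.
    have e : ([ffun i => X i w] : 'I_n -> nat) = (fun i => X i w).
      by apply/funext => i; rewrite ffunE.
    case: pselect => [Qx /= i _|[]]; last by rewrite e.
    by rewrite ffunE.
  move=> [x _]; case: pselect => //= Qx wx.
  suff -> : (fun i => X i w) = x by [].
  by apply/funext => i; exact: wx.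
apply: countable_bigcupT_measurable; first exact: countableP.
move=> x; case: pselect => [Qx|nQx] /=; last exact: measurable0.
apply: fin_bigcap_measurable => // i _; rewrite -[X in measurable X]setTI.
exact: measurable_funPT.
Qed.

Definition atom (x : points) : set T := [set w | forall i, X i w = (x i).+1].

Lemma measurable_atom x : measurable (atom x).
Proof. exact: (measurable_vector_event (fun v => forall i, v i = (x i).+1)). Qed.

Lemma prob_atom x : P (atom x) = ((M ^ n)%:R^-1)%:E.
Proof.
have := X_indep finset.setT (A := fun i => [set (x i).+1]) (fun i => I).
have -> : [set w | forall i : 'I_n, i \in finset.setT -> [set (x i).+1] (X i w)] = atom x.
  by apply/seteqP; split => w h i; [apply: h; rewrite inE|move=> _; exact: h].
move=> ->; under eq_bigr => i _.
  have -> : P (X i @^-1` [set (x i).+1]) = (M%:R^-1)%:E.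
    by apply: X_unif; rewrite ltnS ltn_ord.
  over.
rewrite prodEFin; congr (_%:E).
by rewrite prodr_const cardsT card_ord exprVn natrX.
Qed.

Lemma trivIset_atom (D : set points) : trivIset D atom.
Proof.
move=> x y _ _ [w [wx wy]]; apply/ffunP => i; apply/val_inj => /=.
by apply/succn_inj; rewrite -wx -wy.
Qed.

Lemma integral_atoms (s : seq points) (f : ('I_n -> nat) -> R) : uniq s ->
  (forall v, 0 <= f v) ->
  (\int[P]_(w in \big[setU/set0]_(x <- s) atom x) (f (fun i => X i w))%:E)%E =
  ((\sum_(x <- s) f (fun i => (x i).+1)) / (M ^ n)%:R)%:E.
Proof.
move=> us f0; rewrite ge0_integral_bigsetU//=.
- rewrite mulr_suml -sumEFin; apply: eq_bigr => x _.
  rewrite (eq_integral (cst (f (fun i => (x i).+1))%:E)); last first.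
    move=> w; rewrite inE => wx; rewrite /cst; congr ((f _)%:E).
    by apply/funext => i; exact: wx.
  rewrite integral_cst; last exact: measurable_atom.
  by rewrite -[X in (_ * X)%E]/(P (atom x)) prob_atom -EFinM.
- exact: measurable_atom.
- exact: trivIset_atom.
- move=> mD Y mY; apply: measurableI => //.
  exact: (measurable_vector_event (fun v => Y (f v)%:E)).
- by move=> w _; rewrite lee_fin.
Qed.

Lemma prob_atoms (s : seq points) : uniq s ->
  P (\big[setU/set0]_(x <- s) atom x) = ((size s)%:R / (M ^ n)%:R)%:E.
Proof.
move=> us; have := @integral_atoms s (fun=> 1) us (fun=> ler01).
rewrite big_const_seq count_predT iter_addr_0 => <-.
rewrite integral_cst ?mul1e//.
by apply: bigsetU_measurable => x _; exact: measurable_atom.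
Qed.

(** The M^n atoms have total mass 1, so their complement is null and the integral reduces to a
    finite sum. *)
Lemma expectation_vector (f : ('I_n -> nat) -> R) : (forall v, 0 <= f v) ->
  ('E_P[fun w => f (fun i => X i w)] =
   ((\sum_(x : points) f (fun i => (x i).+1)) / (M ^ n)%:R)%:E)%E.
Proof.
move=> f0; rewrite unlock -(integral_atoms (index_enum_uniq _) f0).
set D := \big[setU/set0]_(x <- _) _.
have mD : measurable D by apply: bigsetU_measurable => x _; exact: measurable_atom.
have PD : P (~` D) = 0.
  rewrite probability_setC// prob_atoms ?index_enum_uniq//.
  rewrite (_ : size _ = (M ^ n)%N) ?divff ?subee//.
    by rewrite pnatr_eq0 expn_eq0; lia.
  transitivity #|{: points}|; last by rewrite card_ffun !card_ord.
  by rewrite -sum1_size -sum1_card.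
rewrite -[in RHS](setCK D) -[in RHS](setTD (~` D)).
apply: ge0_negligible_integral => //; first exact: measurableC.
  move=> mT Y mY; apply: measurableI => //.
  exact: (measurable_vector_event (fun v => Y (f v)%:E)).
by move=> w _; rewrite lee_fin.
Qed.

(** The union of the relevant atoms lies in the event; only this lower bound is called for in the
    conclusion. *)
Lemma prob_vector_ge (Q : pred ('I_n -> nat)) :
  ((#|[pred x : points | Q (fun i => (x i).+1)]|%:R / (M ^ n)%:R)%:E <=
   P [set w | Q (fun i => X i w)])%E.
Proof.
rewrite cardE -prob_atoms ?enum_uniq//; apply: le_measure; rewrite ?inE.
- by apply: bigsetU_measurable => x _; exact: measurable_atom.
- exact: (measurable_vector_event (fun v => Q v)).
- rewrite -bigcup_seq => w [x /=]; rewrite mem_enum inE => Qx wx.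
  suff -> : (fun i => X i w) = (fun i => (x i).+1) by [].
  by apply/funext => i; exact: wx.
Qed.

End UniformVectors.

Lemma limn_einf_ge (R : realType) (u : (\bar R)^nat) (c : \bar R) :
  (\forall n \near \oo, (c <= u n)%E) -> (c <= limn_einf u)%E.
Proof.
move=> [N _ hN]; rewrite limn_einf_lim; apply: lime_ge; first exact: is_cvg_einfs.
exists N => // n /= Nn; apply: le_ereal_inf_tmp => _ [k /= nk <-].
by apply: hN => /=; exact: leq_trans nk.
Qed.

(** The limit may be infinite. A real c1 strictly between leaves a uniform margin above the
    threshold. *)
Lemma eventually_gt_between (R : realType) (u : R^nat) (c : R) (l : \bar R) :
  (u n)%:E @[n --> \oo] --> l -> (c%:E < l)%E ->
  exists c1, c < c1 /\ \forall n \near \oo, c1 < u n.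
Proof.
move=> ul cl; have [c1 [cc1 c1l]] : exists c1, c < c1 /\ (c1%:E < l)%E.
  case: l cl {ul} => [r||]//; rewrite ?lte_fin => cr.
    by exists ((c + r) / 2); rewrite lte_fin; split; lra.
  by exists (c + 1); rewrite ltry; split=> //; lra.
exists c1; split=> //.
have /ul : nbhs l [set y | (c1%:E < y)%E].
  by apply: open_nbhs_nbhs; split => //; exact: open_ereal_gt_ereal.
by [].
Qed.

Theorem theorem4p1 (R : realType) (nu : nat) (hnu : (3 <= nu)%N)
  (M : nat -> nat) (M_gt0 : forall n, (0 < M n)%N)
  (M_infty : M n @[n --> \oo] --> \oo)
  (d : nat -> measure_display) (T : forall n, measurableType (d n))
  (P : forall n, probability (T n) R)
  (X : forall n, 'I_n -> {RV (P n) >-> nat})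
  (X_indep : forall n, mutually_independent (X n))
  (X_unif : forall n (i : 'I_n), uniform_on_1_to (M n) (X n i))
  (l : \bar R)
  (M_lim : (n%:R / ln (M n)%:R : R)%:E @[n --> \oo] --> l)
  (l_gt : ((2 * (nu%:R - 1) / ln ((1 - 2 * nu%:R ^- 2)^-1) : R)%:E < l)%E) :
  (exists b : R, 1 < b /\
     \forall n \near \oo, ((b ^+ n)%:E <= 'E_(P n)[Z nu (X n)])%E) /\
  (forall delta : R, 0 < delta < 1 ->
     (((1 - delta) ^+ 2 / ((1 - delta) ^+ 2 + nu%:R ^+ 2))%:E <=
      limn_einf (fun n =>
        P n [set w | (delta%:E * 'E_(P n)[Z nu (X n)] <=
                      (Z nu (X n) w)%:E)%E]))%E).
Proof.
(* [S1 n] is the expectation of Z multiplied by the number M^n of grid points, for n > 0. *)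
pose S1 n := (\sum_(x : {ffun 'I_n -> 'I_(M n)}) num_balanced nu (fun j => (x j).+1))%N.
have [c1 [cc1 [n1 _ hn1]]] := eventually_gt_between M_lim l_gt.
have [n0 hn0] := moments_eventually hnu cc1.
have [n2 _ hn2] : \forall n \near \oo, (4 <= M n)%N :=
  M_infty _ (nbhs_infty_ge 4).
pose N := maxn n0 (maxn n1 n2).
have big n : (N <= n)%N ->
  [/\ (0 < n)%N, 2 ^+ n * (M n ^ n)%:R <= (S1 n)%:R :> R &
      (\sum_(x : {ffun 'I_n -> 'I_(M n)}) num_balanced nu (fun j => (x j).+1) ^ 2)%:R
        * (M n ^ n)%:R <= (1 + nu%:R ^+ 2) * (S1 n)%:R ^+ 2 :> R].
  rewrite !geq_max => /and3P[h0 h1 h2]; have M4 : (4 <= M n)%N := hn2 n h2.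
  (* As M >= 4, the logarithm is positive, so the bound on the quotient becomes one on n. *)
  apply: hn0 => //; have /ltW := hn1 n h1; rewrite ler_pdivlMr// ln_gt0//.
  by rewrite ltr1n; exact: leq_trans M4.
have ZE n (x : 'I_n -> 'I_(M n)) : (0 < n)%N ->
    num_perfect_partitions nu (fun j => (x j).+1) = num_balanced nu (fun j => (x j).+1).
  by move=> n_gt0; exact: num_perfect_partitionsE.
have EZ n : (0 < n)%N -> ('E_(P n)[Z nu (X n)] = ((S1 n)%:R / (M n ^ n)%:R)%:E)%E.
  move=> n_gt0.
  have := @expectation_vector R _ _ (P n) n (M n) (X n) (X_indep n) (X_unif n) (M_gt0 n)
    (fun v => (num_perfect_partitions nu v)%:R) (fun v => ler0n _ _).
  move=> ->; congr ((_ / _)%:E); rewrite natr_sum; apply: eq_bigr => x _.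
  by rewrite ZE.
have Mn n : 0 < (M n ^ n)%:R :> R by rewrite ltr0n expn_gt0 M_gt0.
split.
  (* The base 2 comes from the lower bound 2^n M^n <= [S1 n]. *)
  exists 2; split; first by rewrite ltr1n.
  exists N => // n /= /big[n_gt0 S2 _].
  by rewrite EZ// lee_fin ler_pdivlMr.
move=> delta /andP[d0 d1]; apply: limn_einf_ge; exists N => // n /= /big[n_gt0 h1 h2].
have S0 : 0 < (S1 n)%:R :> R by apply: lt_le_trans h1; rewrite mulr_gt0// exprn_gt0.
rewrite EZ//.
pose z (x : {ffun 'I_n -> 'I_(M n)}) : R := (num_balanced nu (fun j => (x j).+1))%:R.
have zS : \sum_x z x = (S1 n)%:R by rewrite natr_sum.
have cardE : #|{: {ffun 'I_n -> 'I_(M n)}}|%:R = (M n ^ n)%:R :> R.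
  by rewrite card_ffun !card_ord.
have := @cantelli_count R _ z (nu%:R ^+ 2) delta.
rewrite zS cardE => /(_ S0 (sqr_ge0 _) d1) C.
have {}C := C _.
pose Q (v : 'I_n -> nat) := delta * ((S1 n)%:R / (M n ^ n)%:R) <=
  (num_perfect_partitions nu v)%:R :> R.
have := @prob_vector_ge R _ _ (P n) n (M n) (X n) (X_indep n) (X_unif n) Q.
apply: le_trans; rewrite lee_fin ler_pdivlMr//.
have -> : #|[pred x : {ffun 'I_n -> 'I_(M n)} | Q (fun i => (x i).+1)]| =
  #|[pred x | delta * ((S1 n)%:R / (M n ^ n)%:R) <= z x]|.
  by apply: eq_card => x; rewrite !inE /Q ZE.
apply: C; apply: le_trans h2; rewrite le_eqVlt; apply/orP; left; apply/eqP.
rewrite natr_sum; congr (_ * _); apply: eq_bigr => x _.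
by rewrite /z natrX.
Qed.
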